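(* Suppose $G$ is a $3$-connected graph with at least $5$ vertices. Then $\mathrm{fix}(M(G))=\mathrm{fix}(B(G))$, where $M(G)$ is the cycle matroid of $G$ and $B(G)$ is the bicircular matroid of $G$.
   Context: An automorphism of a matroid $M$ on ground set $E$ is a bijection $\phi:E\to E$ such that, for every $C\subseteq E$, $\phi(C)$ is a circuit if and only if $C$ is a circuit. A subset $S\subseteq E$ is a fixing set if the only automorphism of $M$ that fixes every element of $S$ is the identity. The fixing number $\mathrm{fix}(M)$ is the minimum size of a fixing set of $M$. The cycle matroid $M(G)$ is the matroid on the edge set of $G$ whose circuits are the edge sets of the cycles of $G$. The bicircular matroid $B(G)$ is the matroid on the edge set of $G$ whose circuits are the edge sets of the bicycles of $G$, i.e., of the subgraphs of $G$ that are subdivisions of one of the following graphs: two loops incident to the same vertex; two loops (at distinct vertices) joined by an edge; three edges joining the same pair of vertices. A graph is $3$-connected if it has at least $4$ vertices and remains connected after removal of any set of fewer than $3$ vertices.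
   Formalization: The graph G is additionally assumed to have no loops (parallel edges are allowed); with loops the claim fails, e.g. for K_5 with one loop added at a vertex, where fix(M(G)) = 3 but fix(B(G)) = 2. *)

(* Defs.v *)
From mathcomp Require Import all_boot all_fingroup.
From mathcomp Require Import boolp.
From mathcomp Require Import zify.

Set Implicit Arguments.
Unset Strict Implicit.
Unset Printing Implicit Defensive.

Record matroid (E : finType) := Matroid {
  circuit : pred {set E};
  circuit_neq0 : ~~ circuit set0;
  circuit_antichain : forall C D, circuit C -> circuit D -> C \subset D -> C = D;
  circuit_elim : forall C D e, circuit C -> circuit D -> C != D ->
    e \in C :&: D -> exists2 K, circuit K & K \subset (C :|: D) :\ e
}.

Section FixingNumber.
Variables (E : finType) (M : matroid E).

Definition automorphism (phi : {perm E}) : bool :=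
  [forall C : {set E}, circuit M (phi @: C) == circuit M C].

Definition fixing_set (S : {set E}) : bool :=
  [forall phi : {perm E},
     automorphism phi ==> [forall e in S, phi e == e] ==> (phi == 1%g)].

(* The whole ground set is always a fixing set, so the minimum exists. *)
Definition fixing_number : nat :=
  #|[arg min_(S < [set: E] | fixing_set S) #|S| ]|.

End FixingNumber.

(* [src] and [tgt] list the two ends of an edge in an arbitrary order; every
   notion below is insensitive to that order. *)
Record mgraph := MGraph {
  vert : finType;
  edge : finType;
  src : edge -> vert;
  tgt : edge -> vert
}.
Arguments src {m} e.
Arguments tgt {m} e.

Definition joins (G : mgraph) (e : edge G) (u v : vert G) : bool :=
  ((src e == u) && (tgt e == v)) || ((src e == v) && (tgt e == u)).

(* [three_connected] below does not exclude loops.  The vertex at which a loop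
   sits can be recovered from the bicircular matroid but not from the cycle
   matroid, so the two must not be compared on graphs with loops. *)
Definition loopless (G : mgraph) : Prop := forall e : edge G, src e != tgt e.

Definition adjacent_avoiding (G : mgraph) (X : {set vert G}) : rel (vert G) :=
  [rel u v | [&& u \notin X, v \notin X & [exists e, joins e u v]]].

Definition three_connected (G : mgraph) : Prop :=
  4 <= #|vert G| /\
  forall X : {set vert G}, #|X| < 3 ->
    {in ~: X &, forall u v, connect (adjacent_avoiding X) u v}.

(* [s] lists the pairs (v_i, e_i) of a closed walk v_0 e_0 v_1 e_1 ... in which
   e_i joins v_i to its cyclic successor; a loop is a cycle of length one and
   two parallel edges form a cycle of length two. *)
Definition is_cycle (G : mgraph) (C : {set edge G}) : Prop :=
  exists s : seq (vert G * edge G),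
    [/\ s != [::], uniq (unzip1 s), uniq (unzip2 s),
        path.cycle [rel p q | joins p.2 p.1 q.1] s
      & C = [set e in unzip2 s]].

(* The edge [e0] is replaced by a path of length two through the new vertex
   [None], with edges [Some e0] and [None]. *)
Definition subdivide_edge (G : mgraph) (e0 : edge G) : mgraph :=
  @MGraph (option (vert G)) (option (edge G))
    (fun e => if e is Some e' then Some (src e') else None)
    (fun e => match e with
              | Some e' => if e' == e0 then None else Some (tgt e')
              | None => Some (tgt e0)
              end).

Inductive subdivision (K : mgraph) : mgraph -> Prop :=
| subdivision_refl : subdivision K K
| subdivision_step H (e : edge H) :
    subdivision K H -> subdivision K (subdivide_edge e).

Definition two_loops : mgraph :=
  @MGraph unit bool (fun=> tt) (fun=> tt).

Definition two_loops_joined : mgraph :=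
  @MGraph bool (option bool) (odflt false) (odflt true).

Definition three_parallel_edges : mgraph :=
  @MGraph bool 'I_3 (fun=> false) (fun=> true).

(* [f] and [g] identify [H] with a subgraph of [G]. *)
Definition embedding (H G : mgraph) (f : vert H -> vert G)
    (g : edge H -> edge G) : Prop :=
  [/\ injective f, injective g & forall e, joins (g e) (f (src e)) (f (tgt e))].

Definition is_bicycle (G : mgraph) (C : {set edge G}) : Prop :=
  exists K H : mgraph,
    [/\ [\/ K = two_loops, K = two_loops_joined | K = three_parallel_edges],
        subdivision K H
      & exists f g, @embedding H G f g /\ C = [set g e | e : edge H]].

Definition covered (G : mgraph) (F : {set edge G}) : {set vert G} :=
  [set v | [exists e in F, (src e == v) || (tgt e == v)]].

(* For k = 1 (resp. k = 0) the minimal sets with this property are the cycles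
   (resp. the bicycles). *)
Definition dense (G : mgraph) (k : nat) (F : {set edge G}) : bool :=
  (F != set0) && (#|covered F| < #|F| + k).

Section Counting.
Variable G : mgraph.
Implicit Types (F S C D : {set edge G}) (e : edge G) (v : vert G) (k : nat).

Lemma coveredP F v :
  reflect (exists2 e, e \in F & (src e == v) || (tgt e == v)) (v \in covered F).
Proof. by rewrite inE; exact: exists_inP. Qed.

Lemma covered_src F e : e \in F -> src e \in covered F.
Proof. by move=> eF; apply/coveredP; exists e; rewrite ?eqxx. Qed.

Lemma covered_tgt F e : e \in F -> tgt e \in covered F.
Proof. by move=> eF; apply/coveredP; exists e; rewrite ?eqxx ?orbT. Qed.

Lemma coveredS F S : F \subset S -> covered F \subset covered S.
Proof.
move=> /subsetP FS; apply/subsetP=> v /coveredP[e /FS eS ev].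
by apply/coveredP; exists e.
Qed.

Lemma coveredU F S : covered (F :|: S) = covered F :|: covered S.
Proof.
apply/eqP; rewrite eqEsubset; apply/andP; split; last first.
  by rewrite subUset !coveredS ?subsetUl ?subsetUr.
apply/subsetP=> v /coveredP[e]; rewrite !inE => /orP[] eF ev; apply/orP.
  by left; apply/exists_inP; exists e.
by right; apply/exists_inP; exists e.
Qed.

Lemma covered_gt0 F : F != set0 -> 0 < #|covered F|.
Proof.
case/set0Pn=> e eF; apply/card_gt0P; exists (src e); exact: covered_src.
Qed.

Lemma covered_submod F S :
  #|covered (F :|: S)| + #|covered (F :&: S)| <= #|covered F| + #|covered S|.
Proof.
rewrite coveredU -[X in _ <= X]cardsUI leq_add2l subset_leq_card //.
by rewrite subsetI !coveredS ?subsetIl ?subsetIr.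
Qed.

Lemma minset_proper k C S :
  minset (dense k) C -> S \proper C -> S != set0 -> #|S| + k <= #|covered S|.
Proof.
move=> /minsetP[_ Cmin] SC S0; rewrite leqNgt; apply/negP=> dS.
have := Cmin S; rewrite /dense S0 dS (proper_sub SC) => /(_ isT isT) eSC.
by rewrite eSC properxx in SC.
Qed.

Lemma minset_neq0 k C : minset (dense k) C -> C != set0.
Proof. by case/minsetP=> /andP[]. Qed.

Lemma minset_card k C : k <= 1 -> minset (dense k) C -> #|C| + k = #|covered C|.+1.
Proof.
move=> k1 mC; have [/andP[C0 dC] _] := minsetP mC.
apply/eqP; rewrite eqn_leq dC andbT.
have [e eC] := set0Pn _ C0.
have cC := cardsD1 e C; rewrite eC /= in cC.
have [E0|N0] := eqVneq (C :\ e) set0.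
  by rewrite E0 cards0 in cC; have := covered_gt0 C0; lia.
have := minset_proper mC (properD1 eC) N0.
have := subset_leq_card (coveredS (subD1set C e)); lia.
Qed.

Lemma minset_dense_elim k C D e : minset (dense k) C -> minset (dense k) D ->
  C != D -> e \in C :&: D ->
  exists2 K, minset (dense k) K & K \subset (C :|: D) :\ e.
Proof.
move=> mC mD nCD eCD.
have [/andP[_ dC] _] := minsetP mC; have [/andP[_ dD] Dmin] := minsetP mD.
have pI : C :&: D \proper C.
  rewrite properE subsetIl; apply/negP=> CI.
  have CD : C \subset D by apply: subset_trans CI (subsetIr _ _).
  by have [dnC _] := minsetP mC; move: nCD; rewrite (Dmin C) ?eqxx.
have I0 : C :&: D != set0 by apply/set0Pn; exists e.
have hI := minset_proper mC pI I0.
have hs := covered_submod C D.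
have hc := cardsUI C D.
have eU : e \in C :|: D by move: eCD; rewrite !inE => /andP[-> _].
have cU := cardsD1 e (C :|: D); rewrite eU /= in cU.
have hU := subset_leq_card (coveredS (subD1set (C :|: D) e)).
suff : dense k ((C :|: D) :\ e) by case/minset_exists=> K mK sK; exists K.
rewrite /dense; apply/andP; split; last by lia.
apply: contra nCD; rewrite setD_eq0 subUset => /andP[Ce De].
move: eCD; rewrite inE => /andP[eC eD].
have -> : C = [set e] by apply/eqP; rewrite eqEsubset Ce sub1set.
by rewrite eqEsubset De sub1set eD.
Qed.

Lemma minset_dense_antichain k C D :
  minset (dense k) C -> minset (dense k) D -> C \subset D -> C = D.
Proof. by move=> /minsetP[dC _] /minsetP[_ Dmin]; exact: Dmin. Qed.

End Counting.

Section Transport.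
Variables (H G : mgraph) (f : vert H -> vert G) (g : edge H -> edge G).
Hypothesis fg : embedding f g.
Implicit Types F S : {set edge H}.

Lemma covered_imset F : covered (g @: F) = f @: covered F.
Proof.
have [_ _ J] := fg; apply/setP=> v; apply/coveredP/imsetP.
  case=> _ /imsetP[e eF ->] ev.
  have : (v == f (src e)) || (v == f (tgt e)).
    move: (J e) ev; rewrite /joins.
    by case/orP=> /andP[/eqP-> /eqP->] /orP[]/eqP->; rewrite eqxx ?orbT.
  case/orP=> /eqP->; [exists (src e)|exists (tgt e)] => //.
    exact: covered_src.
  exact: covered_tgt.
case=> w /coveredP[e eF ew] ->; exists (g e); first exact: imset_f.
move: (J e); rewrite /joins.
case/orP=> /andP[/eqP-> /eqP->]; case/orP: ew => /eqP->; by rewrite eqxx ?orbT.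
Qed.

Lemma dense_imset k F : dense k (g @: F) = dense k F.
Proof.
have [fI gI _] := fg.
by rewrite /dense covered_imset !card_imset // imset_eq0.
Qed.

Lemma minset_imset k F : minset (dense k) (g @: F) = minset (dense k) F.
Proof.
have [_ gI _] := fg; apply/minsetP/minsetP.
  case=> dF Fmin; rewrite dense_imset in dF; split=> // S dS SF.
  by apply: (imset_inj gI); apply: Fmin; rewrite ?dense_imset ?imsetS.
case=> dF Fmin; split=> [|S dS SF]; first by rewrite dense_imset.
have ES : S = g @: (g @^-1: S).
  apply/setP=> x; apply/idP/imsetP=> [xS|[y]]; last by rewrite inE => ? ->.
  have /imsetP[y yF xy] := subsetP SF _ xS.
  by exists y; rewrite ?inE -?xy.
rewrite ES in dS SF *; rewrite dense_imset in dS; suff -> : g @^-1: S = F by [].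
apply: Fmin => //; apply/subsetP=> x xS.
have /imsetP[y yF /gI ->//] := subsetP SF _ (imset_f g xS).
Qed.

End Transport.

Definition tight (H : mgraph) : Prop :=
  covered [set: edge H] = [set: vert H] /\ minset (dense 0) [set: edge H].

Lemma tight_card H : tight H -> #|edge H| = #|vert H|.+1.
Proof. by case=> cH /minset_card; rewrite cH !cardsT addn0; apply. Qed.

Lemma tightI H : (forall v : vert H, exists e, (src e == v) || (tgt e == v)) ->
  #|vert H| < #|edge H| ->
  (forall F : {set edge H}, dense 0 F -> F = [set: edge H]) -> tight H.
Proof.
move=> cov lt min.
have cT : covered [set: edge H] = [set: vert H].
  by apply/setP=> v; rewrite in_setT; apply/coveredP; have [e ev] := cov v; exists e.
split=> //; apply/minsetP; split=> [|F dF _]; last exact: min.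
rewrite /dense cT !cardsT addn0 lt andbT -card_gt0 cardsT.
exact: leq_ltn_trans lt.
Qed.

Lemma two_loops_tight : tight two_loops.
Proof.
apply: tightI => [[]||F /andP[F0 dF]]; first by exists true.
  by rewrite card_unit card_bool.
apply/eqP; rewrite eqEcard subsetT cardsT card_bool.
have := covered_gt0 F0; lia.
Qed.

Lemma two_loops_joined_tight : tight two_loops_joined.
Proof.
apply: tightI => [v||F /andP[F0 dF]]; first by exists (Some v); rewrite eqxx.
  by rewrite card_option card_bool.
apply/eqP; rewrite eqEcard subsetT cardsT card_option card_bool.
have c0 := covered_gt0 F0; apply/negPn/negP=> hF.
have c1 : #|covered F| <= 1 by lia.
have F2 : 1 < #|F| by lia.
have inj := card_le1_eqP c1.
case/card_gt1P: F2 => x [y [xF yF]]; case/negP; apply/eqP.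
have NF : None \notin F.
  by apply/negP=> nF; have := inj _ _ (covered_src nF) (covered_tgt nF).
case: x xF => [x|] xF; last by rewrite xF in NF.
case: y yF => [y|] yF; last by rewrite yF in NF.
by have /= -> := inj _ _ (covered_src xF) (covered_src yF).
Qed.

Lemma three_parallel_edges_tight : tight three_parallel_edges.
Proof.
apply: tightI => [v||F /andP[F0 dF]].
- by exists ord0; case: v.
- by rewrite card_ord card_bool.
apply/eqP; rewrite eqEcard subsetT cardsT card_ord.
suff cF : covered F = [set: bool] by rewrite cF cardsT card_bool in dF; lia.
case/set0Pn: F0 => e eF; apply/setP=> v; rewrite in_setT.
by case: v; [exact: (covered_tgt eF) | exact: (covered_src eF)].
Qed.

Lemma subdivide_edge_tight H (e0 : edge H) : tight H -> tight (subdivide_edge e0).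
Proof.
move=> tH; have [cH mH] := tH; have [_ Hmin] := minsetP mH.
apply: tightI => [v||F' /andP[F0 dF]].
- case: v => [v|]; last by exists None.
  have : v \in covered [set: edge H] by rewrite cH.
  case/coveredP=> e _ /orP[] /eqP <-; first by exists (Some e); rewrite eqxx.
  have [->|ne] := eqVneq e e0; first by exists None; rewrite /= ?eqxx ?orbT.
  by exists (Some e); rewrite /= (negPf ne) ?eqxx ?orbT.
- by rewrite /= !card_option tight_card.
pose D := Some @^-1: F' : {set edge H}.
have DinF e : (e \in D) = (Some e \in F') by rewrite inE.
have cF : #|F'| = (None \in F') + #|D|.
  have FD : F' :\ None = Some @: D.
    apply/setP=> -[e|]; last by rewrite setD11; apply/esym/imsetP; case.
    by rewrite in_setD1 mem_imset ?inE //; exact: Some_inj.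
  by rewrite (cardsD1 None) FD card_imset //; exact: Some_inj.
have vN : (None \in F') || (Some e0 \in F') -> None \in covered F'.
  by case/orP=> h; apply/coveredP; [exists None|exists (Some e0)]; rewrite //= ?eqxx.
have vD (X : {set edge H}) : X \subset D -> (Some e0 \in F' -> None \notin F' -> e0 \notin X) ->
    #|covered X| + (None \in covered F') <= #|covered F'|.
  move=> XD hX; rewrite addnC [X in _ <= X](cardsD1 None) leq_add2l.
  rewrite -(card_imset _ (@Some_inj _)); apply: subset_leq_card.
  apply/subsetP=> _ /imsetP[v vX ->]; rewrite in_setD1 /=.
  have /coveredP[e eX] := vX; have : Some e \in F' by have := subsetP XD e eX; rewrite inE.
  move=> eF /orP[]/eqP<-; first by apply/(@coveredP (subdivide_edge e0)); exists (Some e); rewrite //= eqxx.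
  have [ee|ne] := eqVneq e e0; last first.
    by apply/(@coveredP (subdivide_edge e0)); exists (Some e); rewrite //= (negPf ne) ?eqxx ?orbT.
  apply/(@coveredP (subdivide_edge e0)); exists None; rewrite /= ?ee ?eqxx ?orbT //.
  by apply: contraT => nF; rewrite ee in eF eX; have := hX eF nF; rewrite eX.
have DT (X : {set edge H}) : dense 0 X -> X = [set: edge H] by move=> dX; apply: Hmin.
have [nF|nF] := boolP (None \in F'); have [sF|sF] := boolP (Some e0 \in F').
- have hv := vD D (subxx _) (fun _ h => False_ind _ (negP h nF)).
  rewrite vN ?nF // in hv.
  have D0 : D != set0 by apply/set0Pn; exists e0; rewrite inE.
  have DE : D = [set: edge H] by apply: DT; rewrite /dense D0 /=; lia.
  by apply/setP=> -[e|]; rewrite in_setT // -DinF DE in_setT.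
- have hv := vD D (subxx _) (fun h _ => False_ind _ (negP sF h)).
  rewrite vN ?nF // in hv.
  have [D0|D0] := eqVneq D set0.
    by have := covered_gt0 F0; rewrite D0 cards0 in cF; lia.
  have DE : D = [set: edge H] by apply: DT; rewrite /dense D0 /=; lia.
  by rewrite -DinF DE in_setT in sF.
- have hv := vD (D :\ e0) (subD1set _ _) (fun _ _ => _).
  have {}hv := hv (negbT (setD11 _ _)).
  rewrite vN ?sF ?orbT // in hv.
  have e0D : e0 \in D by rewrite inE.
  have cD := cardsD1 e0 D; rewrite e0D /= in cD.
  have [D0|D0] := eqVneq (D :\ e0) set0.
    by have := covered_gt0 F0; rewrite D0 cards0 in cD; lia.
  have DE : D :\ e0 = [set: edge H] by apply: DT; rewrite /dense D0 /=; lia.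
  by have := setD11 e0 D; rewrite DE inE.
- have hv := vD D (subxx _) (fun h _ => False_ind _ (negP sF h)).
  have D0 : D != set0.
    by rewrite -card_gt0; have := covered_gt0 F0; lia.
  have DE : D = [set: edge H] by apply: DT; rewrite /dense D0 /=; lia.
  by rewrite -DinF DE in_setT in sF.
Qed.

Lemma bicycle_minset G (C : {set edge G}) : is_bicycle C -> minset (dense 0) C.
Proof.
case=> K [H [hK hH [f [g [fg ->]]]]].
suff [_ mH] : tight H.
  rewrite -(minset_imset fg) in mH; move: mH; congr minset.
  by apply/setP=> x; apply/imsetP/imsetP=> -[y _ ->]; exists y.
elim: hH => [|H' e _ tH']; last exact: subdivide_edge_tight.
case: hK => ->; [exact: two_loops_tight | exact: two_loops_joined_tight |
  exact: three_parallel_edges_tight].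
Qed.

Lemma joins_sym (G : mgraph) (e : edge G) u v : joins e u v = joins e v u.
Proof. by rewrite /joins orbC. Qed.

Section Degree.
Variable H : mgraph.
Implicit Types (v : vert H) (e : edge H).

Definition mult e v : nat := (src e == v) + (tgt e == v).

Lemma mult_gt0 e v : (0 < mult e v) = (src e == v) || (tgt e == v).
Proof. by rewrite /mult; do 2!case: eqP. Qed.

Lemma sum_mult_vert e : \sum_v mult e v = 2.
Proof.
have aux (x : vert H) : \sum_v (x == v) = 1.
  by rewrite (bigD1 x) //= eqxx big1 // => v; rewrite eq_sym => /negPf ->.
by rewrite big_split /= !aux.
Qed.

Lemma sum_degree : \sum_v \sum_e mult e v = 2 * #|edge H|.
Proof.
rewrite exchange_big /= (eq_bigr (fun=> 2)) => [|e _]; last exact: sum_mult_vert.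
by rewrite sum_nat_const mulnC.
Qed.

Definition suppressible v e1 e2 : Prop :=
  [/\ e1 != e2, forall e, (src e == v) || (tgt e == v) = (e == e1) || (e == e2),
      src e1 != tgt e1 & src e2 != tgt e2].

Lemma tight_degree v : tight H ->
  3 <= \sum_e mult e v \/ exists e1 e2, suppressible v e1 e2.
Proof.
move=> tH; have [cH mH] := tH; have cE := tight_card tH.
pose S := [set e | (src e == v) || (tgt e == v)].
have hS : \sum_e mult e v = \sum_(e in S) mult e v.
  rewrite [LHS](bigID (mem S)) /= [X in _ + X]big1 ?addn0 // => e.
  by rewrite inE -mult_gt0 lt0n negbK => /eqP.
have S2 : 1 < #|S|.
  have v0 : 0 < #|vert H| by apply/card_gt0P; exists v.
  have cS := cardsC S; have [E0|N0] := eqVneq (~: S) set0.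
    by rewrite E0 cards0 in cS; lia.
  have pS : ~: S \proper [set: edge H].
    have : v \in covered [set: edge H] by rewrite cH.
    case/coveredP=> e _ ev; rewrite properT; apply/eqP=> ST.
    by have := in_setT e; rewrite -ST !inE ev.
  have := minset_proper mH pS N0.
  have : covered (~: S) \subset [set~ v].
    apply/subsetP=> w /coveredP[e]; rewrite !inE => eS ew.
    by apply: contraNneq eS => <-.
  by move/subset_leq_card; rewrite cardsC1; lia.
have [S3|] := ltnP 2 #|S|.
  left; rewrite hS; apply: leq_trans S3 _; rewrite -sum1_card.
  by apply: leq_sum => e; rewrite inE -mult_gt0.
move=> S2'; have : #|S| == 2 by rewrite eqn_leq S2' S2.
case/cards2P=> e1 [e2 [ne eS]].
have hS12 e : (src e == v) || (tgt e == v) = (e == e1) || (e == e2).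
  by have /setP/(_ e) := eS; rewrite !inE.
have hm : \sum_e mult e v = mult e1 v + mult e2 v.
  by rewrite hS eS big_setU1 ?inE // big_set1.
have m1 : 0 < mult e1 v by rewrite mult_gt0 hS12 eqxx.
have m2 : 0 < mult e2 v by rewrite mult_gt0 hS12 eqxx orbT.
have loop e : 0 < mult e v -> src e = tgt e -> mult e v = 2.
  by rewrite /mult => + E; rewrite E; case: eqP.
have [l1|l1] := eqVneq (src e1) (tgt e1).
  by left; rewrite hm (loop _ m1 l1); lia.
have [l2|l2] := eqVneq (src e2) (tgt e2).
  by left; rewrite hm (loop _ m2 l2); lia.
by right; exists e1, e2.
Qed.

End Degree.

Definition bicyclic (H : mgraph) : Prop :=
  exists K H0 : mgraph,
    [/\ [\/ K = two_loops, K = two_loops_joined | K = three_parallel_edges],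
        subdivision K H0
      & exists f g, @embedding H0 H f g /\ forall e, exists e0, g e0 = e].

Lemma bicyclic_base H : tight H -> (forall v : vert H, 3 <= \sum_e mult e v) ->
  bicyclic H.
Proof.
move=> tH deg3; have cE := tight_card tH; have sd := sum_degree H.
have V2 : #|vert H| <= 2.
  have : \sum_(v : vert H) 3 <= \sum_v \sum_(e : edge H) mult e v by exact: leq_sum.
  rewrite sum_nat_const sd cE [#|_|]cardT -cardT; lia.
have V0 : 0 < #|vert H|.
  have : 0 < #|edge H| by lia.
  by case/card_gt0P=> e _; apply/card_gt0P; exists (src e).
have [V1|V2'] : #|vert H| = 1 \/ #|vert H| = 2 by lia.
  have Vu (x y : vert H) : x = y.
    have /card_le1_eqP h : #|vert H| <= 1 by rewrite V1.
    exact: h.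
  have /card_gt0P[v _] := V0.
  have : #|[set: edge H]| == 2 by rewrite cardsT cE V1.
  case/cards2P=> e1 [e2 [ne ET]].
  exists two_loops, two_loops; split; [exact: Or31|exact: subdivision_refl|].
  exists (fun=> v), (fun b : bool => if b then e1 else e2); split; last first.
    move=> e; have := in_setT e; rewrite ET !inE => /orP[]/eqP->.
      by exists true.
    by exists false.
  split=> [[][]//|[] [] // E|b]; try by rewrite E eqxx in ne.
  by rewrite /joins (Vu (src _) v) ?(Vu (tgt _) v) ?eqxx.
have deg (v : vert H) : \sum_(e : edge H) mult e v = 3.
  apply/eqP; rewrite eqn_leq deg3 andbT leqNgt; apply/negP=> gt.
  have : \sum_(w : vert H) (3 + (w == v)) <= \sum_w \sum_(e : edge H) mult e w.
    apply: leq_sum => w _; have [->|_] := eqVneq w v; first by [].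
    by rewrite addn0.
  rewrite big_split /= sum_nat_const sd cE V2' => h.
  have : 0 < \sum_(w : vert H) (w == v : nat).
    by rewrite (bigD1 v) //= eqxx.
  move: h; lia.
have [/forallP ll|/forallPn[l /negPn/eqP ll]] :=
  boolP [forall e : edge H, src e != tgt e].
  have : #|[set: vert H]| == 2 by rewrite cardsT V2'.
  case/cards2P=> a [b [nab VT]].
  have E3 : 3 = #|edge H| by rewrite cE V2'.
  exists three_parallel_edges, three_parallel_edges.
  split; [exact: Or33|exact: subdivision_refl|].
  exists (fun x : bool => if x then b else a).
  exists (fun i : 'I_3 => enum_val (cast_ord E3 i)).
  split; last first.
    move=> e; exists (cast_ord (esym E3) (enum_rank e)).
    by rewrite cast_ordKV enum_rankK.
  split=> [[][]// E|i j /enum_val_inj/cast_ord_inj//|i]; try by rewrite E eqxx in nab.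
  rewrite /joins /=; move: (enum_val _) => e; have := ll e.
  have := in_setT (src e); have := in_setT (tgt e); rewrite VT !inE.
  by case/orP=> /eqP-> /orP[]/eqP->; rewrite !eqxx ?orbT.
have ml : mult l (src l) = 2 by rewrite /mult -ll eqxx.
have : #|[set: edge H] :\ l| == 2.
  by have := cardsD1 l [set: edge H]; rewrite in_setT cardsT cE V2' /=; lia.
have : #|[set: vert H] :\ src l| == 1.
  by have := cardsD1 (src l) [set: vert H]; rewrite in_setT cardsT V2' /=; lia.
case/cards1P=> w VT /cards2P[x0 [y0 [nxy0 ET0]]].
have dl := deg (src l); rewrite (bigD1 l) //= ml in dl.
have sD : \sum_(e | e != l) mult e (src l) = mult x0 (src l) + mult y0 (src l).
  rewrite (eq_bigl (fun e => e \in [set x0; y0])) => [|e]; last first.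
    by rewrite -ET0 !inE andbT.
  by rewrite big_setU1 ?inE // big_set1.
have [x [y [nxy ET mx my]]] : exists x y, [/\ x != y,
    [set: edge H] :\ l = [set x; y], mult x (src l) = 1 & mult y (src l) = 0].
  have [h|h] : mult x0 (src l) = 1 \/ mult y0 (src l) = 1 by lia.
    by exists x0, y0; split=> //; lia.
  by exists y0, x0; split=> //; [rewrite eq_sym|rewrite setUC|lia].
have Vw v : v != src l -> v = w.
  by move=> nv; apply/set1P; rewrite -VT !inE nv.
have wl : w != src l by have := set11 w; rewrite -VT !inE andbT.
have [xl yl] : x != l /\ y != l.
  by have := set21 x y; have := set22 x y; rewrite -ET !inE !andbT.
have jy : src y = w /\ tgt y = w.
  by move: my; rewrite /mult; do 2!case: eqP => // /eqP/Vw ->.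
have jx : joins x (src l) w.
  move: mx; rewrite /mult /joins.
  by do 2!(case: eqVneq => [->|/Vw->]); rewrite ?eqxx ?orbT //.
exists two_loops_joined, two_loops_joined.
split; [exact: Or32|exact: subdivision_refl|].
exists (fun b : bool => if b then w else src l).
exists (fun e : option bool => match e with None => x
  | Some true => y | Some false => l end).
split; last first.
  move=> e; have [->|ne] := eqVneq e l; first by exists (Some false).
  have : e \in [set x; y] by rewrite -ET !inE ne.
  by rewrite !inE => /orP[]/eqP->; [exists None|exists (Some true)].
split.
- by move=> [][] // E; rewrite E eqxx in wl.
- move=> [[]|] [[]|] // E; move: nxy xl yl; by rewrite E eqxx.
- case=> [[]|] //=; rewrite /joins; last by rewrite -ll eqxx.
  by case: jy => -> ->; rewrite eqxx.
Qed.

Section Suppress.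
Variables (H : mgraph) (v : vert H) (e1 e2 : edge H).
Hypothesis sup : suppressible v e1 e2.

Definition other_end (e : edge H) : vert H := if src e == v then tgt e else src e.

Let V' : finType := {x : vert H | x != v}.
Let E' : finType := {e : edge H | e != e2}.

Lemma other_end_joins e : (e == e1) || (e == e2) ->
  joins e (other_end e) v /\ other_end e != v.
Proof.
have [ne inc l1 l2] := sup => h.
have lp : src e != tgt e by case/orP: h => /eqP->.
have := inc e; rewrite h /other_end /joins; case: eqVneq => [sv _|nsv].
  by rewrite -sv eqxx (eq_sym (tgt e)) lp ?eqxx ?orbT.
by move=> /= /eqP->; rewrite ?eqxx.
Qed.

Let oth1 : other_end e1 != v.
Proof. by apply: (other_end_joins _).2; rewrite eqxx. Qed.

Definition suppress : mgraph :=
  @MGraph V' E'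
    (fun e => insubd (Sub (other_end e1) oth1 : V')
       (if val e == e1 then other_end e1 else src (val e)))
    (fun e => insubd (Sub (other_end e1) oth1 : V')
       (if val e == e1 then other_end e2 else tgt (val e))).

Let valV (x : vert suppress) : vert H := val (x : V').
Let valE (e : edge suppress) : edge H := val (e : E').

Let valV_inj : injective valV. Proof. exact: val_inj. Qed.
Let valE_inj : injective valE. Proof. exact: val_inj. Qed.
Let valVP x : valV x != v. Proof. exact: (valP (x : V')). Qed.
Let valEP e : valE e != e2. Proof. exact: (valP (e : E')). Qed.

Lemma val_src_suppress (e : edge suppress) :
  valV (src e) = if valE e == e1 then other_end e1 else src (valE e).
Proof.
have [_ inc _ _] := sup; rewrite /valV insubdK // unfold_in.
case: (eqVneq (valE e) e1) => [_|ne]; first exact: oth1.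
have := inc (valE e).
by rewrite (negPf ne) (negPf (valEP e)) => /negbT; rewrite negb_or => /andP[].
Qed.

Lemma val_tgt_suppress (e : edge suppress) :
  valV (tgt e) = if valE e == e1 then other_end e2 else tgt (valE e).
Proof.
have [_ inc _ _] := sup; rewrite /valV insubdK // unfold_in.
case: (eqVneq (valE e) e1) => [_|ne].
  by apply: (other_end_joins _).2; rewrite eqxx orbT.
have := inc (valE e).
by rewrite (negPf ne) (negPf (valEP e)) => /negbT; rewrite negb_or => /andP[].
Qed.

Let ne12 : e1 != e2. Proof. by case: sup. Qed.
Let e1' : edge suppress := Sub e1 ne12 : E'.

Definition unsuppress (F : {set edge suppress}) : {set edge H} :=
  valE @: F :|: (if e1' \in F then [set e2] else set0).

Lemma card_unsuppress F : #|unsuppress F| = #|F| + (e1' \in F).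
Proof.
rewrite /unsuppress cardsU card_imset; last exact: valE_inj.
rewrite (_ : _ :&: _ = set0) ?cards0 ?subn0; first by case: ifP; rewrite ?cards1 ?cards0.
apply/setP=> e; rewrite !inE; apply/negP=> /andP[/imsetP[x _ ->]].
by case: ifP => _; rewrite inE // (negPf (valEP x)).
Qed.

Lemma covered_unsuppress F :
  covered (unsuppress F) =
  (valV @: covered F) :|: (if e1' \in F then [set v] else set0).
Proof.
have [_ inc l1 l2] := sup.
have [j1 o1] : joins e1 (other_end e1) v /\ other_end e1 != v.
  by apply: other_end_joins; rewrite eqxx.
have [j2 o2] : joins e2 (other_end e2) v /\ other_end e2 != v.
  by apply: other_end_joins; rewrite eqxx orbT.
have ends (e : edge H) a b : joins e a b ->
    forall x, (src e == x) || (tgt e == x) = (x == a) || (x == b).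
  by move=> + x; rewrite /joins !(eq_sym x) => /orP[]/andP[/eqP-> /eqP->] //; rewrite orbC.
have E1 := ends _ _ _ j1; have E2 := ends _ _ _ j2.
apply/setP=> x; apply/idP/idP.
  case/coveredP=> e; rewrite inE => /orP[/imsetP[e' eF ->]|].
    have [ee|ne] := eqVneq (valE e') e1.
      have -> : e1' \in F by rewrite (_ : e1' = e') //; exact: valE_inj.
      rewrite ee E1 => /orP[]/eqP->; rewrite !inE ?eqxx ?orbT //.
      apply/orP; left; apply/imsetP; exists (src e'); first exact: covered_src.
      by rewrite val_src_suppress ee eqxx.
    case/orP=> /eqP <-; rewrite inE; apply/orP; left; apply/imsetP.
      by exists (src e'); rewrite ?covered_src // val_src_suppress (negPf ne).
    by exists (tgt e'); rewrite ?covered_tgt // val_tgt_suppress (negPf ne).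
  case: ifP => [e1F|_]; rewrite inE // => /eqP->; rewrite E2 => /orP[]/eqP->.
    rewrite inE; apply/orP; left; apply/imsetP; exists (tgt e1').
      exact: covered_tgt.
    by rewrite val_tgt_suppress eqxx.
  by rewrite !inE eqxx orbT.
have val_in e' : e' \in F -> valE e' \in unsuppress F.
  by move=> eF; rewrite inE imset_f.
rewrite inE => /orP[/imsetP[y /coveredP[e' eF ey] ->]|]; last first.
  case: ifP => [e1F|_]; rewrite inE // => /eqP->.
  by apply/coveredP; exists e1; [exact: (val_in e1')|rewrite E1 eqxx orbT].
have [ee|ne] := eqVneq (valE e') e1; last first.
  apply/coveredP; exists (valE e'); first exact: val_in.
  move: ey; rewrite -!(inj_eq valV_inj) val_src_suppress val_tgt_suppress (negPf ne).
  by [].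
have ee' : e1' = e' by exact: valE_inj.
move: ey; rewrite -!(inj_eq valV_inj) val_src_suppress val_tgt_suppress ee eqxx.
case/orP=> /eqP<-; apply/coveredP.
  by exists e1; [rewrite -ee; exact: val_in|rewrite E1 eqxx].
by exists e2; [rewrite inE ee' eF set11 orbT|rewrite E2 eqxx].
Qed.

Lemma dense_unsuppress F : dense 0 F -> dense 0 (unsuppress F).
Proof.
case/andP=> F0 dF; rewrite /dense -card_gt0 card_unsuppress.
rewrite covered_unsuppress addn_gt0 card_gt0 F0 /=.
apply: (leq_ltn_trans (leq_card_setU _ _)); move: dF.
rewrite card_imset; last exact: valV_inj.
by case: (e1' \in F); rewrite ?cards1 ?cards0 ?addn0 ?addn1 ?ltnS.
Qed.

Lemma suppress_tight : tight H -> tight suppress.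
Proof.
move=> tH; have [cH mH] := tH; have cE := tight_card tH.
have cV : #|vert suppress| = #|vert H|.-1.
  by rewrite card_sig -(cardC1 v); apply: eq_card.
have cE' : #|edge suppress| = #|edge H|.-1.
  by rewrite card_sig -(cardC1 e2); apply: eq_card.
have uT : unsuppress [set: edge suppress] = [set: edge H].
  apply/setP=> e; rewrite in_setT inE in_setT.
  have [->|ne] := eqVneq e e2; first by rewrite set11 orbT.
  by apply/orP; left; apply/imsetP; exists (Sub e ne).
apply: tightI => [x||F dF].
- have : valV x \in covered (unsuppress [set: edge suppress]) by rewrite uT cH.
  rewrite covered_unsuppress in_setT inE => /orP[|].
    by case/imsetP=> y /coveredP[e _ ey] /valV_inj->; exists e.
  by rewrite inE (negPf (valVP x)).
- by rewrite cV cE' cE ltn_predL; apply/card_gt0P; exists v.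
have [_ Hmin] := minsetP mH.
have UF := Hmin _ (dense_unsuppress dF) (subsetT _).
apply/setP=> e; rewrite in_setT.
have : valE e \in unsuppress F by rewrite UF in_setT.
rewrite inE => /orP[|]; first by rewrite mem_imset //; exact: valE_inj.
by case: ifP => _; rewrite inE // (negPf (valEP e)).
Qed.

Lemma unsuppress_bicyclic : bicyclic suppress -> bicyclic H.
Proof.
case=> K [H0 [hK sK [f [g [[fI gI J] gS]]]]].
have [e0 ge0] := gS e1'.
have [_ inc _ _] := sup.
have [j1 o1] : joins e1 (other_end e1) v /\ other_end e1 != v.
  by apply: other_end_joins; rewrite eqxx.
have [j2 o2] : joins e2 (other_end e2) v /\ other_end e2 != v.
  by apply: other_end_joins; rewrite eqxx orbT.
have [a [b [ab nab ja jb]]] : exists a b, [/\ [set a; b] = [set e1; e2], a != b,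
    joins a (valV (f (src e0))) v & joins b (valV (f (tgt e0))) v].
  have h := J e0; rewrite ge0 /joins -!(inj_eq valV_inj) in h.
  rewrite val_src_suppress val_tgt_suppress eqxx in h.
  case/orP: h => /andP[/eqP<- /eqP<-].
    by exists e1, e2.
  by exists e2, e1; split; rewrite // ?(setUC [set e2]) // eq_sym.
exists K, (subdivide_edge e0); split=> //; first exact: subdivision_step.
pose f' (x : option (vert H0)) := if x is Some y then valV (f y) else v.
pose g' (e : option (edge H0)) :=
  if e is Some e' then if e' == e0 then a else valE (g e') else b.
have abP e : (e == a) || (e == b) = (e == e1) || (e == e2).
  by have /setP/(_ e) := ab; rewrite !inE.
have gab e' : e' != e0 -> (valE (g e') == a) || (valE (g e') == b) = false.
  move=> ne; rewrite abP (negPf (valEP (g e'))) orbF.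
  have -> : (valE (g e') == e1) = (g e' == e1') by exact: (inj_eq valE_inj (g e') e1').
  rewrite -ge0 (inj_eq gI); exact: negbTE.
exists f', g'; split; last first.
  move=> e; have [->|na] := eqVneq e a; first by exists (Some e0); rewrite /g' eqxx.
  have [->|nb] := eqVneq e b; first by exists None.
  have := abP e; rewrite (negPf na) (negPf nb) => /esym/negbT.
  rewrite negb_or => /andP[n1 n2].
  have [e' ge'] := gS (Sub e n2 : E'); exists (Some e').
  rewrite /g' ge'; case: eqP => // ee; move: n1.
  by rewrite -ee ge' in ge0; have := congr1 val ge0 => /= ->; rewrite eqxx.
split.
- move=> [x|] [y|] //=; first by move=> /valV_inj/fI->.
    by move=> E; have := valVP (f x); rewrite E eqxx.
  by move=> E; have := valVP (f y); rewrite -E eqxx.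
- move=> [x|] [y|] //=.
  + case: (eqVneq x e0) => [->|nx]; case: (eqVneq y e0) => [->|ny] // E.
    * by have := gab _ ny; rewrite -E eqxx.
    * by have := gab _ nx; rewrite E eqxx.
    * by move/valE_inj/gI: E => ->.
  + case: (eqVneq x e0) => [_|nx] E; first by rewrite E eqxx in nab.
    by have := gab _ nx; rewrite E eqxx orbT.
  + case: (eqVneq y e0) => [_|ny] E; first by rewrite E eqxx in nab.
    by have := gab _ ny; rewrite -E eqxx orbT.
- case=> [e|] /=; last by rewrite joins_sym.
  case: (eqVneq e e0) => [->//|ne] /=.
  have h := J e; rewrite /joins -!(inj_eq valV_inj) in h.
  rewrite val_src_suppress val_tgt_suppress in h.
  suff n1 : valE (g e) != e1 by rewrite (negPf n1) in h.
  have -> : (valE (g e) == e1) = (g e == e1') by exact: (inj_eq valE_inj (g e) e1').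
  by rewrite -ge0 (inj_eq gI).
Qed.

End Suppress.

Lemma tight_bicyclic H : tight H -> bicyclic H.
Proof.
have [n] := ubnP #|vert H|; elim: n H => // n IH H ltn tH.
have [/existsP[v]|/existsPn big] := boolP [exists v : vert H, \sum_e mult e v < 3].
  rewrite ltnNge => sm; have [h|[e1 [e2 sup]]] := tight_degree v tH.
    by rewrite h in sm.
  apply: (unsuppress_bicyclic (sup := sup)).
  apply: IH; last exact: suppress_tight.
  rewrite card_sig (eq_card (B := predC1 v)) // cardC1.
  have : 0 < #|vert H| by apply/card_gt0P; exists v.
  lia.
by apply: bicyclic_base => // v; rewrite leqNgt; exact: big.
Qed.

Lemma minset_bicycle G (C : {set edge G}) : minset (dense 0) C -> is_bicycle C.
Proof.
move=> mC; have [e0 e0C] := set0Pn _ (minset_neq0 mC).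
pose V' : finType := {v : vert G | v \in covered C}.
pose E' : finType := {e : edge G | e \in C}.
pose H : mgraph := @MGraph V' E'
  (fun e => Sub (src (val e)) (covered_src (valP e)))
  (fun e => Sub (tgt (val e)) (covered_tgt (valP e))).
have fg : @embedding H G val val.
  by split=> [||e]; [exact: val_inj|exact: val_inj|rewrite /joins /= !eqxx].
have CE : val @: [set: edge H] = C.
  apply/setP=> e; apply/imsetP/idP=> [[x _ ->]|eC]; first exact: valP.
  by exists (Sub e eC).
have : tight H.
  split; last by rewrite -(minset_imset fg) CE.
  apply/setP=> v; rewrite in_setT; have := covered_imset fg [set: edge H].
  rewrite CE => /setP/(_ (val v)); rewrite (valP v) mem_imset //; exact: val_inj.
case/tight_bicyclic=> K [H0 [hK sK [f [g [[fI gI J] gS]]]]].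
exists K, H0; split=> //; exists (val \o f), (val \o g); split.
  split=> [||e]; [exact: inj_comp val_inj fI|exact: inj_comp val_inj gI|].
  by have := J e; rewrite /joins -!val_eqE.
apply/setP=> e; apply/idP/imsetP=> [eC|[x _ ->]]; last exact: valP.
by have [x gx] := gS (Sub e eC); exists x; rewrite //= gx.
Qed.

Lemma uniq_map_in_inj (S T : eqType) (h : S -> T) (s : seq S) :
  uniq (map h s) -> {in s &, injective h}.
Proof.
elim: s => //= a s IH /andP[as_ us] x y; rewrite !inE.
case/predU1P=> [->|xs] /predU1P[->|ys] // E; last exact: IH.
  by move: as_; rewrite E map_f.
by move: as_; rewrite -E map_f.
Qed.

Lemma joins_ends (G : mgraph) (e : edge G) u v : joins e u v ->
  forall x, (src e == x) || (tgt e == x) = (x == u) || (x == v).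
Proof.
move=> + x; rewrite /joins !(eq_sym x).
by case/orP=> /andP[/eqP-> /eqP->] //; rewrite orbC.
Qed.

Lemma cycle_minset G (C : {set edge G}) : is_cycle C -> minset (dense 1) C.
Proof.
case=> s [s0 u1 u2 cs ->].
have us : uniq s := map_uniq u1.
have i1 := uniq_map_in_inj u1.
have J p : p \in s -> joins p.2 p.1 (next s p).1 by move=> ps; exact: (next_cycle cs ps).
have cC : #|[set e in unzip2 s]| = size s.
  by rewrite cardsE (card_uniqP u2) size_map.
apply/minsetP; split.
  rewrite /dense -card_gt0 cC lt0n size_eq0 s0 /= addn1 ltnS.
  rewrite -(size_map fst) -/(unzip1 s) -(card_uniqP u1).
  apply: subset_leq_card; apply/subsetP=> x /coveredP[e].
  rewrite inE => /mapP[p ps ->]; rewrite (joins_ends (J p ps)).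
  by case/orP=> /eqP->; apply: map_f; rewrite ?mem_next.
move=> S /andP[S0 dS] SC.
pose P : {set vert G * edge G} := [set p in s | p.2 \in S].
have SP : S = snd @: P.
  apply/setP=> e; apply/idP/imsetP=> [eS|[p]]; last by rewrite inE => /andP[_ ?] ->.
  have := subsetP SC e eS; rewrite inE => /mapP[p ps ep].
  by exists p; rewrite // inE ps -ep.
have cSP : #|S| <= #|P| by rewrite SP leq_imset_card.
have iP : {in P &, injective fst}.
  by move=> p q; rewrite !inE => /andP[ps _] /andP[qs _]; exact: i1.
have cP := card_in_imset iP.
have PS p : p \in P -> p.1 \in covered S /\ (next s p).1 \in covered S.
  rewrite inE => /andP[ps pS].
  by split; apply/coveredP; exists p.2; rewrite // (joins_ends (J p ps)) eqxx ?orbT.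
have closed p : p \in P -> next s p \in P.
  move=> pP; apply: contraLR dS => nP; rewrite -leqNgt addn1.
  apply: (@leq_trans #|(next s p).1 |: fst @: P|).
    rewrite cardsU1 cP; suff -> : (next s p).1 \notin fst @: P by rewrite ltnS.
    apply: contra nP => /imsetP[q qP E].
    have [qs ps] : q \in s /\ p \in s by move: qP pP; rewrite !inE => /andP[-> _] /andP[-> _].
    by rewrite (i1 _ _ _ qs E) ?mem_next.
  apply: subset_leq_card; rewrite subUset sub1set (PS _ pP).2 /=.
  by apply/subsetP=> _ /imsetP[q qP ->]; exact: (PS _ qP).1.
have [p pP] : exists p, p \in P.
  by apply/set0Pn; apply: contraNneq S0 => P0; rewrite SP P0 imset0.
have ps : p \in s by move: pP; rewrite inE => /andP[].
apply/eqP; rewrite eqEsubset SC; apply/subsetP=> e; rewrite inE => /mapP[q qs ->].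
have : fconnect (next s) p q by rewrite (fconnect_cycle (cycle_next us) ps).
move/iter_findex=> <-; set n := findex _ _ _.
suff : iter n (next s) p \in P by rewrite inE => /andP[].
by elim: n => //= n; exact: closed.
Qed.

Section ExtractCycle.
Variables (G : mgraph) (C : {set edge G}).
Hypothesis mC : minset (dense 1) C.

Lemma loop_cycle e : e \in C -> src e = tgt e -> is_cycle C.
Proof.
move=> eC le; have [_ Cmin] := minsetP mC.
have -> : C = [set e].
  apply/esym/Cmin; last by rewrite sub1set.
  rewrite /dense -card_gt0 cards1 /=.
  have : covered [set e] \subset [set src e].
    apply/subsetP=> x /coveredP[_ /set1P-> ]; rewrite -le orbb => /eqP->.
    exact: set11.
  by move/subset_leq_card; rewrite cards1.
exists [:: (src e, e)]; split=> //=; first by rewrite /joins -le !eqxx.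
by apply/setP=> x; rewrite !inE.
Qed.

Hypothesis nl : forall e, e \in C -> src e != tgt e.

Lemma other_edge v e : v \in covered C ->
  exists e', [/\ e' \in C, e' != e & (src e' == v) || (tgt e' == v)].
Proof.
move=> vC; pose S := [set x in C | (src x == v) || (tgt x == v)].
have SC : S \subset C by apply/subsetP=> x; rewrite inE => /andP[].
have cC : #|C| = #|covered C| by have := minset_card (leqnn 1) mC; rewrite addn1 => -[].
have cS : #|C :\: S| + #|S| = #|C|.
  by rewrite -(cardsID S C) (setIidPr SC) addnC.
have S2 : 1 < #|S|.
  have [E0|N0] := eqVneq (C :\: S) set0.
    rewrite E0 cards0 in cS; rewrite [#|S|]cS cC.
    have [x xC] := set0Pn _ (minset_neq0 mC).
    apply/card_gt1P; exists (src x), (tgt x).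
    by rewrite covered_src // covered_tgt // nl.
  have pS : C :\: S \proper C.
    rewrite properE subsetDl; apply/subsetPn.
    have /coveredP[x xC xv] := vC; exists x => //.
    by rewrite !inE xC xv.
  have := minset_proper mC pS N0.
  have : covered (C :\: S) \subset covered C :\ v.
    apply/subsetP=> w wS; rewrite !in_setD1 (subsetP (coveredS (subsetDl C S)) _ wS) andbT.
    case/coveredP: wS => x; rewrite !inE => /andP[xS xC].
    by apply: contraTneq => E; move: xS; rewrite xC E.
  move/subset_leq_card; have := cardsD1 v (covered C); rewrite vC; lia.
have : 0 < #|S :\ e| by have := cardsD1 e S; lia.
case/card_gt0P=> e'; rewrite !inE => /and3P[ne e'C ev].
by exists e'.
Qed.

(* Paths are listed backwards: each entry (v, e) is the vertex [v] together with
   the edge [e] leading from it to the preceding entry. *)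
Let r : rel (vert G * edge G) := [rel p q | (q.2 \in C) && joins q.2 q.1 p.1].

Lemma path_ends p s q v : path r p s -> q \in s ->
  (src q.2 == v) || (tgt q.2 == v) -> v \in p.1 :: unzip1 s.
Proof.
elim: s p => //= a s IH p /andP[/andP[_ ja] ps]; rewrite inE => /predU1P[->|qs] qv.
  by move: qv; rewrite (joins_ends ja) !inE => /orP[]->; rewrite ?orbT.
by rewrite inE (IH a ps qs qv) orbT.
Qed.

Lemma path_edges p s q : path r p s -> q \in s -> q.2 \in C.
Proof.
elim: s p => //= a s IH p /andP[/andP[aC _] ps]; rewrite inE.
by case/predU1P=> [->|/(IH a ps)].
Qed.

Lemma extract_cycle n p q s : #|vert G| <= n + size s ->
  path r p (q :: s) -> uniq (p.1 :: unzip1 (q :: s)) -> uniq (unzip2 (q :: s)) ->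
  exists2 D, is_cycle D & D \subset C.
Proof.
elim: n p q s => [|n IH] p q s.
  move=> h _ u _; have := max_card (mem (p.1 :: unzip1 (q :: s))).
  move=> h2; have := leq_trans h2 h; rewrite (card_uniqP u) /= size_map; lia.
move=> hn rs u u2.
have /andP[/andP[qC jq] rq] : r p q && path r q s by [].
have pC : p.1 \in covered C.
  by apply/coveredP; exists q.2; rewrite // (joins_ends jq) eqxx orbT.
have [e [eC ne ep]] := other_edge q.2 pC.
have eN : e \notin unzip2 (q :: s).
  rewrite /= inE (negPf ne) /=; apply/mapP=> -[a as_ ea].
  have := path_ends rq as_ (v := p.1); rewrite -ea => /(_ ep) h.
  by move: u; rewrite /= -[q.1 :: _]/(unzip1 (q :: s)) h.
have [x jx] : exists x, joins e p.1 x.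
  by case/orP: ep => /eqP <-; [exists (tgt e)|exists (src e)]; rewrite /joins !eqxx ?orbT.
have nx : x != p.1.
  apply: contraTneq (nl eC) => xp; rewrite negbK; move: jx.
  by rewrite /joins xp; case/orP=> /andP[/eqP-> /eqP->].
have [xs|xs] := boolP (x \in unzip1 (q :: s)); last first.
  have h1 : #|vert G| <= n + size (q :: s) by rewrite /= addnS -addSn.
  have h2 : path r (x, e) [:: (p.1, e), q & s].
    apply/and3P; split=> //; first by rewrite /r /= eC jx.
    by rewrite /r /= qC jq.
  have h3 : uniq (x :: unzip1 [:: (p.1, e), q & s]).
    apply/andP; split; last exact: u.
    by rewrite in_cons (negPf nx).
  have h4 : uniq (unzip2 [:: (p.1, e), q & s])
    by apply/andP; split; [exact: eN|exact: u2].
  exact: IH h1 h2 h3 h4.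
case/mapP: xs => a aqs xa; subst x.
case/path.splitP: aqs rs u u2 eN => t t' rs u u2 eN.
move: u; rewrite /= /unzip1 map_cat cat_uniq mem_cat negb_or => /andP[/andP[pt _] /andP[ut _]].
move: u2; rewrite /unzip2 map_cat cat_uniq => /andP[u2 _].
move: eN; rewrite /unzip2 map_cat mem_cat negb_or => /andP[eN _].
move: rs; rewrite cat_path => /andP[rt _].
pose c := (p.1, e) :: rcons t a.
have rc : path.cycle [rel p q | joins q.2 q.1 p.1] c.
  rewrite /c /= rcons_path last_rcons /= jx andbT.
  suff : path r (p.1, e) (rcons t a) by apply: sub_path => y z /andP[].
  by case: (rcons t a) rt => [|y l].
exists [set e' in unzip2 (rev c)].
  exists (rev c); split=> //.
  - by rewrite -size_eq0 size_rev.
  - by rewrite /unzip1 map_rev rev_uniq /= pt.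
  - by rewrite /unzip2 map_rev rev_uniq /= eN.
  - by rewrite rev_cycle.
apply/subsetP=> y; rewrite inE /unzip2 map_rev mem_rev /= inE.
case/predU1P=> [->//|/mapP[z zt ->]].
exact: path_edges rt zt.
Qed.

Lemma minset_extract_cycle : is_cycle C.
Proof.
have [e eC] := set0Pn _ (minset_neq0 mC).
have [D cD DC] : exists2 D, is_cycle D & D \subset C.
  apply: (@extract_cycle #|vert G| (tgt e, e) (src e, e) [::]) => //=.
  - by rewrite addn0.
  - by rewrite andbT; apply/andP; rewrite /joins !eqxx.
  - by rewrite inE eq_sym nl.
have [_ Cmin] := minsetP mC; have [dD _] := minsetP (cycle_minset cD).
by rewrite -(Cmin D).
Qed.

End ExtractCycle.

Lemma minset_cycle G (C : {set edge G}) : minset (dense 1) C -> is_cycle C.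
Proof.
move=> mC; have [/existsP[e /andP[eC /eqP le]]|/existsPn nl] :=
  boolP [exists e, (e \in C) && (src e == tgt e)].
  exact: (loop_cycle mC eC le).
apply: minset_extract_cycle => // e eC; have := nl e.
by rewrite eC.
Qed.

Section GraphMatroids.
Variable G : mgraph.

Lemma cycleP (C : {set edge G}) : `[< is_cycle C >] = minset (dense 1) C.
Proof. by apply/asboolP/idP; [exact: cycle_minset|exact: minset_cycle]. Qed.

Lemma bicycleP (C : {set edge G}) : `[< is_bicycle C >] = minset (dense 0) C.
Proof. by apply/asboolP/idP; [exact: bicycle_minset|exact: minset_bicycle]. Qed.

Lemma cycle_neq0 : ~~ `[< is_cycle (set0 : {set edge G}) >].
Proof. by rewrite cycleP; apply/negP=> /minset_neq0; rewrite eqxx. Qed.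

Lemma cycle_antichain (C D : {set edge G}) :
  `[< is_cycle C >] -> `[< is_cycle D >] -> C \subset D -> C = D.
Proof. by rewrite !cycleP; exact: minset_dense_antichain. Qed.

Lemma cycle_elim (C D : {set edge G}) e :
  `[< is_cycle C >] -> `[< is_cycle D >] -> C != D -> e \in C :&: D ->
  exists2 K : {set edge G}, `[< is_cycle K >] & K \subset (C :|: D) :\ e.
Proof.
rewrite !cycleP => mC mD ne eCD.
by have [K mK sK] := minset_dense_elim mC mD ne eCD; exists K; rewrite ?cycleP.
Qed.

Lemma bicycle_neq0 : ~~ `[< is_bicycle (set0 : {set edge G}) >].
Proof. by rewrite bicycleP; apply/negP=> /minset_neq0; rewrite eqxx. Qed.

Lemma bicycle_antichain (C D : {set edge G}) :
  `[< is_bicycle C >] -> `[< is_bicycle D >] -> C \subset D -> C = D.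
Proof. by rewrite !bicycleP; exact: minset_dense_antichain. Qed.

Lemma bicycle_elim (C D : {set edge G}) e :
  `[< is_bicycle C >] -> `[< is_bicycle D >] -> C != D -> e \in C :&: D ->
  exists2 K : {set edge G}, `[< is_bicycle K >] & K \subset (C :|: D) :\ e.
Proof.
rewrite !bicycleP => mC mD ne eCD.
by have [K mK sK] := minset_dense_elim mC mD ne eCD; exists K; rewrite ?bicycleP.
Qed.

Definition cycle_matroid : matroid (edge G) :=
  @Matroid (edge G) (fun C => `[< is_cycle C >])
    cycle_neq0 cycle_antichain cycle_elim.

Definition bicircular_matroid : matroid (edge G) :=
  @Matroid (edge G) (fun C => `[< is_bicycle C >])
    bicycle_neq0 bicycle_antichain bicycle_elim.

End GraphMatroids.

(* Main.v *)
(* Both matroids have the same automorphisms: those induced by automorphisms of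
   [G].  Write k = 1 for the cycle matroid and k = 0 for the bicircular one, so
   that the circuits are the minimal edge sets F with |V(F)| < |F| + k.  Let phi
   be an automorphism.  If every image phi(E(G - v)) is some E(G - w), then
   v |-> w is the required map of vertices, and for that it is enough that
   phi(E(G - v)) covers at most |V| - 1 vertices.  Its independent sets have at
   most |V| - 1 - k elements, so one only has to see that it contains an
   independent set as large as its number of vertices minus k.  For k = 1 this
   holds because it is connected: adjacent edges of G - v lie in a common cycle
   of G - v, hence their images lie in a cycle.  For k = 0 it holds because each
   edge of G - v lies in a bicycle of G - v, unless G - v is a cycle.  As
   |V| >= 5 this exception occurs for at most one v, which is then mapped to
   itself. *)
Require Import Defs.
From mathcomp Require Import all_boot.
From mathcomp Require Import all_fingroup boolp zify.

Set Implicit Arguments.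
Unset Strict Implicit.
Unset Printing Implicit Defensive.

(** * Independent sets and connectedness, for both matroids at once *)

Section IndependentSets.
Variables (G : mgraph) (k : nat).
Hypotheses (nl : loopless G) (k1 : k <= 1).
Implicit Types (F X Y C D : {set edge G}) (S V : {set vert G}) (e : edge G).

(** Every dense set contains a minimal one, so these are the sets without a circuit; dense subsets
    are easier to count with. *)
Definition independent F : bool :=
  [forall D : {set edge G}, (D \subset F) ==> ~~ dense k D].

Lemma independentP F :
  reflect (forall D, D \subset F -> ~~ dense k D) (independent F).
Proof.
by apply: (iffP forallP) => h D; [exact: implyP (h D)|exact/implyP/h].
Qed.

Lemma independentS F D : D \subset F -> independent F -> independent D.
Proof.
move=> DF /independentP iF; apply/independentP=> D' sD.
exact: iF (subset_trans sD DF).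
Qed.

Lemma independent_card F : independent F -> F != set0 -> #|F| + k <= #|covered F|.
Proof.
by move=> /independentP/(_ _ (subxx F)); rewrite /dense => + F0; rewrite F0 -leqNgt.
Qed.

Lemma independent0 : independent set0.
Proof. by apply/independentP=> D; rewrite subset0 => /eqP->; rewrite /dense eqxx. Qed.

(** A dense set through [e] loses one edge and at least the vertex [w] when [e] is removed, so the
    rest would be dense inside [Y]. A single edge is not dense because it has two distinct ends. *)
Lemma independent_pendant Y e w : (src e == w) || (tgt e == w) ->
  w \notin covered Y -> independent Y -> independent (e |: Y).
Proof.
move=> ew wY iY; apply/independentP=> D sD; apply/negP=> dD.
have [eD|neD] := boolP (e \in D); last first.
  move/independentP: iY => /(_ D); rewrite dD; suff -> : D \subset Y by move/(_ isT).
  apply/subsetP=> x xD; have := subsetP sD x xD; rewrite !inE.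
  by case: eqP xD neD => [-> ->|].
have D'Y : D :\ e \subset Y by rewrite subDset.
have cD := cardsD1 e D; rewrite eD in cD.
have /andP[_ dD'] := dD.
have [D0|D0] := eqVneq (D :\ e) set0.
  have : [set src e; tgt e] \subset covered D.
    by rewrite subUset !sub1set covered_src ?covered_tgt.
  move/subset_leq_card; rewrite cards2 nl; rewrite D0 cards0 in cD; lia.
have := independent_card (independentS D'Y iY) D0.
have : w |: covered (D :\ e) \subset covered D.
  rewrite subUset sub1set coveredS ?subD1set // andbT.
  by apply/coveredP; exists e.
move/subset_leq_card; rewrite cardsU1.
have -> : w \notin covered (D :\ e).
  by apply: contra wY; apply/subsetP/coveredS.
lia.
Qed.

Definition crosses S e : bool := (src e \in S) (+) (tgt e \in S).

(** Connectedness stated by cuts rather than walks, the form in which the maximality arguments below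
    use it. *)
Definition connects X V : Prop :=
  forall S x y, x \in V -> x \in S -> y \in V -> y \notin S ->
    exists2 e, e \in X & crosses S e.

Lemma crosses_covered X e : e \in X -> ~~ crosses (covered X) e.
Proof. by move=> eX; rewrite /crosses covered_src ?covered_tgt. Qed.

(** An uncrossed cut would split [C] into two proper nonempty parts on disjoint vertex sets. Neither
    part is dense, so adding their counts gives [C] too many vertices. *)
Lemma minset_connects C : minset (dense k) C -> connects C (covered C).
Proof.
move=> mC S x y xC xS yC yS; apply/exists_inP; apply: contraT.
move/exists_inPn=> ncr.
pose C1 := [set e in C | src e \in S].
have C1C : C1 \subset C by apply/subsetP=> e; rewrite inE => /andP[].
have C2C : C :\: C1 \subset C by exact: subsetDl.
have s1 : covered C1 \subset S.
  apply/subsetP=> z /coveredP[e]; rewrite inE => /andP[eC eS].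
  have := ncr e eC; rewrite /crosses eS /= negbK => tS.
  by case/orP=> /eqP <-.
have s2 : covered (C :\: C1) \subset ~: S.
  apply/subsetP=> z /coveredP[e]; rewrite !inE => /andP[+ eC]; rewrite eC /= => eS.
  have := ncr e eC; rewrite /crosses (negPf eS) /= => tS.
  by case/orP=> /eqP <-.
have cU : C1 :|: (C :\: C1) = C by have := setID C C1; rewrite (setIidPr C1C).
have z1 : x \in covered C1.
  move: xC; rewrite -{1}cU coveredU inE => /orP[//|/(subsetP s2)].
  by rewrite inE xS.
have z2 : y \in covered (C :\: C1).
  move: yC; rewrite -{1}cU coveredU inE => /orP[/(subsetP s1)|//].
  by rewrite (negPf yS).
have [e1 e1C _] := coveredP _ _ z1; have [e2 e2C _] := coveredP _ _ z2.
have p1 : C1 \proper C.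
  rewrite properE C1C; apply/subsetPn; exists e2; first exact: (subsetP C2C).
  by move: e2C; rewrite inE => /andP[].
have p2 : C :\: C1 \proper C.
  rewrite properE C2C; apply/subsetPn; exists e1; first exact: (subsetP C1C).
  by rewrite inE e1C.
have h1 : #|C1| + k <= #|covered C1|.
  by apply: minset_proper mC p1 _; apply/set0Pn; exists e1.
have h2 : #|C :\: C1| + k <= #|covered (C :\: C1)|.
  by apply: minset_proper mC p2 _; apply/set0Pn; exists e2.
have hc := minset_card k1 mC.
have hcov : #|covered C| = #|covered C1| + #|covered (C :\: C1)|.
  rewrite -cardsUI -coveredU cU; suff -> : covered C1 :&: covered (C :\: C1) = set0.
    by rewrite cards0 addn0.
  apply/setP=> z; rewrite in_setI in_set0; apply/negP=> /andP[/(subsetP s1) zS].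
  by move/(subsetP s2); rewrite inE zS.
have := cardsID C1 C; rewrite (setIidPr C1C).
by move: hcov hc h2 h1; clear; lia.
Qed.

(* By independence the last condition is an equality unless [Y] is empty. *)
Definition tight_in X Y : bool :=
  [&& Y \subset X, independent Y & #|covered Y| <= #|Y| + k].

(** A crossing edge is pendant on [Y]: adding it brings one edge and one vertex, which keeps [Y]
    independent and tight, against maximality. *)
Lemma maxset_tight_in_crosses X Y e :
  maxset (tight_in X) Y -> e \in X -> ~~ crosses (covered Y) e.
Proof.
move=> /maxsetP[/and3P[YX iY cY] Ymax] eX; apply/negP=> cr.
have [u [w [juw uY wY]]] : exists u w,
    [/\ joins e u w, u \in covered Y & w \notin covered Y].
  move: cr; rewrite /crosses.
  have [sY|sY] := boolP (src e \in _); have [tY|tY] // := boolP (tgt e \in _) => _.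
    by exists (src e), (tgt e); rewrite /joins !eqxx.
  by exists (tgt e), (src e); rewrite /joins !eqxx orbT.
have eY : e \notin Y.
  by apply: contra wY => eY; apply/coveredP; exists e; rewrite // (joins_ends juw) eqxx orbT.
suff /Ymax/(_ (subsetUr _ _)) E : tight_in X (e |: Y) by rewrite -E setU11 in eY.
rewrite /tight_in subUset sub1set eX YX /=; apply/andP; split.
  by apply: independent_pendant wY iY; rewrite (joins_ends juw) eqxx orbT.
have : covered (e |: Y) \subset w |: covered Y.
  rewrite coveredU subUset subsetUr andbT; apply/subsetP=> x /coveredP[_ /set1P->].
  by rewrite (joins_ends juw) => /orP[]/eqP->; rewrite in_setU1 ?uY ?eqxx ?orbT.
move/subset_leq_card; rewrite !cardsU1 eY wY; lia.
Qed.

Lemma connects_maxset_tight_in X V Y x : connects X V -> maxset (tight_in X) Y ->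
  x \in V -> x \in covered Y -> V \subset covered Y.
Proof.
move=> cX mY xV xY; apply/subsetP=> y yV; apply: contraT => yY.
have [e eX] := cX _ _ _ xV xY yV yY.
by rewrite (negPf (maxset_tight_in_crosses mY eX)).
Qed.

End IndependentSets.

(** A maximal tight set covers every vertex of [X]: a bicycle through an edge at a missed vertex
    would be vertex-disjoint from it, and the bicycle minus that edge could be added. *)
Lemma bicycles_span (G : mgraph) (X : {set edge G}) : loopless G ->
  (forall e, e \in X -> exists C, [/\ minset (dense 0) C, e \in C & C \subset X]) ->
  exists F : {set edge G},
    [/\ F \subset X, independent 0 F & #|covered X| <= #|F|].
Proof.
move=> nl cX.
have t0 : tight_in 0 X set0.
  rewrite /tight_in sub0set independent0 /= (_ : covered set0 = set0) ?cards0 //.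
  by apply/setP=> x; rewrite in_set0; apply/negP=> /coveredP[e]; rewrite in_set0.
have [Y mY _] := maxset_exists t0.
have /maxsetP[/and3P[YX iY cY] Ymax] := mY.
exists Y; split=> //; rewrite addn0 in cY; apply: leq_trans (cY).
apply/subset_leq_card/subsetP=> x /coveredP[e eX ex]; apply: contraT => xY.
have [C [mC eC CX]] := cX e eX.
have xC : x \in covered C by apply/coveredP; exists e.
(* [C] is connected and no edge of [X] crosses [covered Y], so [C] lies entirely outside. *)
have disj y : y \in covered C -> y \notin covered Y.
  move=> yC; apply: contraT => /negPn yY.
  have [e' e'C] := minset_connects (leq0n 1) mC yC yY xC xY.
  by rewrite (negPf (maxset_tight_in_crosses nl (leq0n 1) mY (subsetP CX _ e'C))).
have disjE (D D' : {set edge G}) : D \subset Y -> D' \subset C -> covered D :&: covered D' = set0.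
  move=> DY D'C; apply/setP=> y; rewrite in_setI in_set0; apply/negP=> /andP[].
  move/(subsetP (coveredS DY)) => yY /(subsetP (coveredS D'C))/disj.
  by rewrite yY.
have hC := minset_card (leq0n 1) mC; rewrite addn0 in hC.
have ceC := cardsD1 e C; rewrite eC /= in ceC.
have CeC : C :\ e \subset C by exact: subD1set.
have iC : independent 0 (C :\ e).
  apply/independentP=> D sD; apply/negP=> dD; have [_ Cmin] := minsetP mC.
  have DC := Cmin D dD (subset_trans sD CeC).
  by have := subsetP sD e; rewrite DC eC setD11 => /(_ isT).
have card_cov (D : {set edge G}) : independent 0 D -> #|D| <= #|covered D|.
  move=> iD; have [->|D0] := eqVneq D set0; first by rewrite cards0.
  by have := independent_card iD D0; rewrite addn0.
have disjF : Y :&: (C :\ e) = set0.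
  apply/setP=> y; rewrite in_setI in_set0; apply/negP.
  move=> /andP[yY /(subsetP CeC) yC].
  by have := disj _ (covered_src yC); rewrite covered_src.
(* Edge and vertex counts add over the two disjoint pieces, and [C :\ e] has exactly [#|covered C|]
   edges. *)
have : tight_in 0 X (Y :|: C :\ e).
  apply/and3P; split; first by rewrite subUset YX (subset_trans CeC CX).
    apply/independentP=> D sD; rewrite /dense addn0 negb_and -leqNgt; apply/orP; right.
    have DU : D = (D :&: Y) :|: (D :&: (C :\ e)) by rewrite -setIUr; apply/esym/setIidPl.
    have i1 := card_cov _ (independentS (subsetIr D Y) iY).
    have i2 := card_cov _ (independentS (subsetIr D (C :\ e)) iC).
    rewrite {2}DU coveredU cardsU disjE ?subsetIr //; last first.
      exact: subset_trans (subsetIr _ _) CeC.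
    rewrite cards0 subn0; apply: leq_trans (leq_add i1 i2).
    by rewrite {1}DU leq_card_setU.
  rewrite coveredU !cardsU disjE // disjF 2!cards0 !subn0 addn0 leq_add //.
  apply: leq_trans (subset_leq_card (coveredS CeC)) _.
  by rewrite -ltnS -hC ceC.
move/Ymax/(_ (subsetUl _ _)) => YU.
have /set0Pn[c cC] : C :\ e != set0.
  apply/negP=> /eqP E; have := covered_gt0 (minset_neq0 mC).
  by rewrite E cards0 in ceC; move: hC ceC; clear; lia.
have := disj _ (covered_src (subsetP CeC _ cC)).
by rewrite covered_src // -YU inE cC orbT.
Qed.

(** * Edge permutations that preserve circuits *)

Section Preserving.
Variables (G : mgraph) (k : nat) (phi : {perm edge G}).
Hypothesis (k1 : k <= 1).

Definition preserves_minsets : Prop :=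
  forall C : {set edge G}, minset (dense k) (phi @: C) = minset (dense k) C.

Hypothesis pr : preserves_minsets.

Lemma imset_preimset_perm (C : {set edge G}) : phi @: (phi @^-1: C) = C.
Proof.
apply/setP=> e; apply/imsetP/idP => [[x]|eC]; first by rewrite inE => ? ->.
by exists ((phi^-1)%g e); rewrite ?inE permKV.
Qed.

Lemma minset_preimset (C : {set edge G}) :
  minset (dense k) (phi @^-1: C) = minset (dense k) C.
Proof. by rewrite -pr imset_preimset_perm. Qed.

Lemma independent_preimset (F : {set edge G}) :
  independent k F -> independent k (phi @^-1: F).
Proof.
move=> /independentP iF; apply/independentP=> D sD; apply/negP.
case/minset_exists=> C mC CD; rewrite -pr in mC.
have := iF (phi @: C); have [-> _] := minsetP mC.
suff -> : phi @: C \subset F by move/(_ isT).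
apply/subsetP=> _ /imsetP[x xC ->].
by have := subsetP (subset_trans CD sD) x xC; rewrite inE.
Qed.

(** The preimage of [F] is an independent subset of [A] with as many edges, so it covers at least
    [#|F| + k] vertices of [A]. If it is empty, [k <= 1] and one vertex of [A] suffice. *)
Lemma covered_imset_leq (A F : {set edge G}) : A != set0 ->
  F \subset phi @: A -> independent k F -> #|covered (phi @: A)| <= #|F| + k ->
  #|covered (phi @: A)| <= #|covered A|.
Proof.
move=> A0 sF iF le; apply: leq_trans le _.
have FA : phi @^-1: F \subset A.
  apply/subsetP=> x; rewrite inE => /(subsetP sF); rewrite mem_imset //.
  exact: perm_inj.
have cF : #|phi @^-1: F| = #|F|.
  by rewrite -[in RHS](imset_preimset_perm F) card_imset //; exact: perm_inj.
rewrite -cF; have [->|F0] := eqVneq (phi @^-1: F) set0.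
  by rewrite cards0; exact: leq_trans k1 (covered_gt0 A0).
apply: leq_trans (independent_card (independent_preimset iF) F0) _.
exact: subset_leq_card (coveredS FA).
Qed.

End Preserving.

Lemma joins_inj (G : mgraph) (e : edge G) x y z : joins e x y -> joins e x z -> y = z.
Proof.
by rewrite /joins => /orP[]/andP[/eqP-> /eqP->] /orP[]/andP[/eqP ? /eqP ?]; congruence.
Qed.

(** * Connectedness of vertex-deleted subgraphs *)

Section ThreeConnected.
Variable G : mgraph.
Hypotheses (nl : loopless G) (c3 : three_connected G).
Implicit Types (S T : {set vert G}) (u v w x y : vert G) (e : edge G).

Definition avoiding T : {set edge G} := [set e | (src e \notin T) && (tgt e \notin T)].

Lemma mem_avoiding1 v e : (e \in avoiding [set v]) = ~~ ((src e == v) || (tgt e == v)).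
Proof. by rewrite !inE negb_or. Qed.

Lemma covered_avoiding_sub T : covered (avoiding T) \subset ~: T.
Proof.
apply/subsetP=> x /coveredP[e]; rewrite !inE => /andP[sT tT].
by case/orP=> /eqP <-.
Qed.

(** If no edge of [G - T] crosses [S], then [S] is closed under adjacency in [G - T], which is
    connected. *)
Lemma avoiding_connects T : #|T| < 3 -> connects (avoiding T) (~: T).
Proof.
move=> T3 S x y xT xS yT yS; apply/exists_inP; apply: contraT => /exists_inPn ncr.
have cl : closed (adjacent_avoiding T) (mem S).
  move=> a b /and3P[aT bT /existsP[e je]].
  have eA : e \in avoiding T.
    by rewrite inE; case/orP: je => /andP[/eqP-> /eqP->]; rewrite aT bT.
  change ((a \in S) = (b \in S)); have := ncr e eA; rewrite /crosses.
  by case/orP: je => /andP[/eqP-> /eqP->]; case: (a \in S); case: (b \in S).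
have := closed_connect cl (c3.2 T T3 x y xT yT).
by rewrite xS (negPf yS).
Qed.

Lemma vertex_outside T : #|T| < 4 -> exists x, x \notin T.
Proof.
move=> T4; apply/existsP; rewrite -negb_forall; apply/negP=> /forallP h.
have : #|[set: vert G]| <= #|T| by apply/subset_leq_card/subsetP=> x _.
by rewrite cardsT leqNgt (leq_trans T4 c3.1).
Qed.

Lemma exit_edge T x : #|T| < 3 -> x \notin T ->
  exists e y, [/\ joins e x y, y \notin T & e \in avoiding T].
Proof.
move=> T3 xT; have [z] : exists z, z \notin x |: T.
  by apply: vertex_outside; rewrite cardsU1 xT.
rewrite in_setU1 negb_or => /andP[zx zT].
have [||||e eA] := avoiding_connects T3 (S := [set x]) (x := x) (y := z).
- by rewrite inE.
- exact: set11.
- by rewrite inE.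
- by rewrite inE.
rewrite /crosses !inE; have := eA; rewrite inE => /andP[sT tT].
have [sx|sx] := eqVneq (src e) x; have [tx|tx] // := eqVneq (tgt e) x => _.
  by exists e, (tgt e); rewrite /joins sx !eqxx.
by exists e, (src e); rewrite /joins tx !eqxx orbT.
Qed.

Lemma covered_avoiding T : #|T| < 3 -> covered (avoiding T) = ~: T.
Proof.
move=> T3; apply/eqP; rewrite eqEsubset covered_avoiding_sub.
apply/subsetP=> x; rewrite inE => xT; have [e [y [je _ eA]]] := exit_edge T3 xT.
by apply/coveredP; exists e; rewrite // (joins_ends je) eqxx.
Qed.

Lemma avoiding1_neq0 v : avoiding [set v] != set0.
Proof.
have [x xv] : exists x, x \notin [set v] by apply: vertex_outside; rewrite cards1.
have [|e [y [_ _ eA]]] := exit_edge _ xv; first by rewrite cards1.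
by apply/set0Pn; exists e.
Qed.

(** [G - v] has no bridge: deleting one end of [e] together with [v] still leaves a connected graph,
    whose edges are not [e]. *)
Lemma avoiding1_D1_connects v e : connects (avoiding [set v] :\ e) (~: [set v]).
Proof.
move=> S x y xv xS yv yS.
have [|e1 e1A cr] := avoiding_connects _ xv xS yv yS; first by rewrite cards1.
have [ee|ne] := eqVneq e1 e; last by exists e1; rewrite // in_setD1 ne.
rewrite {e1}ee in cr e1A.
have [a [b [je aS bS]]] : exists a b, [/\ joins e a b, a \in S & b \notin S].
  move: cr; rewrite /crosses.
  have [sS|sS] := boolP (src e \in _); have [tS|tS] // := boolP (tgt e \in _) => _.
    by exists (src e), (tgt e); rewrite /joins !eqxx.
  by exists (tgt e), (src e); rewrite /joins !eqxx orbT.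
have [av bv] : a != v /\ b != v.
  move: e1A; rewrite mem_avoiding1 (joins_ends je) negb_or !(eq_sym v).
  by case/andP.
have ab : a != b by apply: contraTneq aS => ->.
(* A third vertex [z] lies on the side of [a] or of [b]; deleting that end of [e] forces another
   crossing edge between [z] and the other end. *)
have [z] : exists z, z \notin [set v; a; b].
  by apply: vertex_outside; rewrite !cardsU !cards1; lia.
rewrite !inE !negb_or -andbA => /and3P[zv za zb].
have sub c f : c \in [set a; b] -> f \in avoiding [set v; c] -> f \in avoiding [set v] :\ e.
  move=> cab; rewrite !inE !negb_or => /andP[/andP[-> fc] /andP[-> fc']]; rewrite !andbT.
  apply: contraTneq cab => fe; rewrite !inE -(joins_ends je) -fe.
  by rewrite negb_or fc.
have card2 c : #|[set v; c]| < 3 by rewrite cards2; case: eqP.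
have [zS|zS] := boolP (z \in S).
  have [||f fA fc] := avoiding_connects (card2 a) (x := z) (y := b) _ zS _ bS.
  - by rewrite !inE negb_or zv.
  - by rewrite !inE negb_or bv eq_sym.
  by exists f; rewrite // (sub a) ?set21.
have [||f fA fc] := avoiding_connects (card2 b) (x := a) (y := z) _ aS _ zS.
- by rewrite !inE negb_or av.
- by rewrite !inE negb_or zv.
by exists f; rewrite // (sub b) ?set22.
Qed.

(** * Images of [G - v] under automorphisms of the cycle matroid *)

(** The seed from which a maximal tight set, here a tree, is grown; it guarantees that the tree
    covers some vertex. *)
Lemma tight_in_set1 (X : {set edge G}) e : e \in X -> tight_in 1 X [set e].
Proof.
move=> eX; rewrite /tight_in sub1set eX cards1 /=; apply/andP; split.
  rewrite -[X in independent 1 X]setU0; apply: (@independent_pendant _ _ nl _ _ _ (src e)) => //.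
  - by rewrite eqxx.
  - by apply/negP=> /coveredP[f]; rewrite in_set0.
  exact: independent0.
have : covered [set e] \subset [set src e; tgt e].
  by apply/subsetP=> x /coveredP[_ /set1P->]; rewrite !inE !(eq_sym x).
move/subset_leq_card => h; apply: leq_trans h _.
by rewrite cards2; case: eqP.
Qed.

(* The cycle is [e] and [e'] closed up by a path in a spanning tree of
   [G - u - v]; it is found by counting. *)
Lemma adjacent_edges_cycle v u e e' :
  e \in avoiding [set v] -> e' \in avoiding [set v] -> e != e' ->
  (src e == u) || (tgt e == u) -> (src e' == u) || (tgt e' == u) ->
  exists C, [/\ minset (dense 1) C, e \in C, e' \in C & C \subset avoiding [set v]].
Proof.
move=> eA e'A ne eu e'u.
have uv : u != v.
  by apply: contraTneq eA => uv; rewrite mem_avoiding1 -uv eu.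
have T3 : #|[set u; v]| < 3 by rewrite cards2; case: eqP.
have [x xT] : exists x, x \notin [set u; v] by apply: vertex_outside; exact: ltnW.
have [e0 [y [je0 _ e0A]]] := exit_edge T3 xT.
have [Y mY e0Y] := maxset_exists (tight_in_set1 e0A).
have /maxsetP[/and3P[YA iY cY] _] := mY.
rewrite sub1set in e0Y.
have xY : x \in covered Y.
  by apply/coveredP; exists e0; rewrite // (joins_ends je0) eqxx.
have xT' : x \in ~: [set u; v] by rewrite inE.
have VY := connects_maxset_tight_in nl (leqnn 1) (avoiding_connects T3) mY xT' xY.
have uY : u \notin covered Y.
  apply/negP=> /(subsetP (subset_trans (coveredS YA) (covered_avoiding_sub _))).
  by rewrite !inE eqxx.
have notY f : (src f == u) || (tgt f == u) -> f \notin Y.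
  by move=> fu; apply: contra uY => fY; apply/coveredP; exists f.
have AA : avoiding [set u; v] \subset avoiding [set v].
  by apply/subsetP=> f; rewrite !inE !negb_or => /andP[/andP[_ ->] /andP[_ ->]].
pose F := e |: (e' |: Y).
have FA : F \subset avoiding [set v].
  by rewrite !subUset !sub1set eA e'A (subset_trans YA).
have cF : #|F| = #|Y|.+2.
  by rewrite !cardsU1 in_setU1 negb_or ne !notY.
have : dense 1 F.
  rewrite /dense -card_gt0 cF /=.
  have : covered F \subset u |: covered Y.
    apply: subset_trans (coveredS FA) _; apply: subset_trans (covered_avoiding_sub _) _.
    apply/subsetP=> z; rewrite in_setU1 => zv.
    have [//|zu] := eqVneq z u; apply: (subsetP VY).
    by move: zv; rewrite !inE negb_or zu.
  by move/subset_leq_card; rewrite cardsU1 uY; move: cY; clear; lia.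
case/minset_exists=> C mC CF; have /minsetP[dC _] := mC.
(* With only one of the two edges at [u], the tree [Y] gains a pendant edge and stays independent;
   hence [C] uses both. *)
have ind f : (src f == u) || (tgt f == u) -> ~~ (C \subset f |: Y).
  move=> fu; apply: contraL dC.
  exact: (independentP _ _ (independent_pendant nl (leqnn 1) fu uY iY)).
exists C; split=> //; last exact: subset_trans CF FA.
  apply: contraR (ind e' e'u) => eC; apply/subsetP=> f fC.
  have := subsetP CF f fC; rewrite [f \in F]in_setU1 => /predU1P[fe|//].
  by rewrite -fe fC in eC.
apply: contraR (ind e eu) => eC; apply/subsetP=> f fC.
have := subsetP CF f fC; rewrite [f \in F]in_setU1 !in_setU1 => /or3P[->//|/eqP fe|->]; last by rewrite orbT.
by rewrite -fe fC in eC.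
Qed.

(** An uncrossed cut [S] would sort the edges of [G - v] by the side of their images. Two adjacent
    edges of different sorts lie in a common cycle of [G - v], whose image is connected and so
    crosses [S]. *)
Lemma imset_avoiding1_connects (phi : {perm edge G}) v : preserves_minsets 1 phi ->
  connects (phi @: avoiding [set v]) (covered (phi @: avoiding [set v])).
Proof.
move=> pr S x y /coveredP[_ /imsetP[e1 e1A ->] xe1] xS.
move=> /coveredP[_ /imsetP[e2 e2A ->] ye2] yS.
apply/exists_inP; apply: contraT => /exists_inPn ncr.
have side e z : e \in avoiding [set v] -> (src (phi e) == z) || (tgt (phi e) == z) ->
    (src (phi e) \in S) = (z \in S).
  move=> eA /orP[] /eqP <- //.
  have := ncr _ (imset_f _ eA); rewrite /crosses.
  by do 2!case: (_ \in S).
pose Z := [set e in avoiding [set v] | src (phi e) \in S].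
have e1Z : e1 \in Z by rewrite inE e1A (side _ _ e1A xe1).
have e2Z : e2 \notin Z by rewrite inE e2A (side _ _ e2A ye2).
(* Either [e2] already touches [Z], or connectedness of [G - v] gives an edge crossing [covered Z],
   which cannot belong to [Z]. *)
have [e3 [u [e3A e3Z e3u uZ]]] : exists e3 u, [/\ e3 \in avoiding [set v], e3 \notin Z,
    (src e3 == u) || (tgt e3 == u) & u \in covered Z].
  have [s2|s2] := boolP (src e2 \in covered Z).
    by exists e2, (src e2); rewrite eqxx.
  have v3 : #|[set v]| < 3 by rewrite cards1.
  have srcA e : e \in avoiding [set v] -> src e \in ~: [set v].
    by rewrite !inE => /andP[].
  have [e3 e3A cr] := avoiding_connects v3 (srcA _ e1A) (covered_src e1Z) (srcA _ e2A) s2.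
  have e3Z : e3 \notin Z by apply: contraL cr; exact: crosses_covered.
  move: cr; rewrite /crosses; have [sZ _|sZ /= tZ] := boolP (src e3 \in _).
    by exists e3, (src e3); rewrite eqxx.
  by exists e3, (tgt e3); rewrite eqxx orbT.
have [e4 e4Z e4u] := coveredP _ _ uZ.
have [e4A e4S] : e4 \in avoiding [set v] /\ src (phi e4) \in S.
  by move: e4Z; rewrite [_ \in Z]inE => /andP[].
have e3S : src (phi e3) \notin S.
  by apply: contra e3Z => e3S; rewrite inE e3A.
have ne : e3 != e4 by apply: contraNneq e3Z => ->.
have [C [mC e3C e4C CA]] := adjacent_edges_cycle e3A e4A ne e3u e4u.
rewrite -pr in mC.
have [_ /imsetP[f fC ->]] := minset_connects (leqnn 1) mC
  (covered_src (imset_f _ e4C)) e4S (covered_src (imset_f _ e3C)) e3S.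
by rewrite (negPf (ncr _ (imset_f _ (subsetP CA f fC)))).
Qed.

Lemma covered_imset_avoiding_cycle (phi : {perm edge G}) v : preserves_minsets 1 phi ->
  #|covered (phi @: avoiding [set v])| <= #|covered (avoiding [set v])|.
Proof.
move=> pr; have /set0Pn[e eA] := avoiding1_neq0 v.
have eX : phi e \in phi @: avoiding [set v] by exact: imset_f.
have [Y mY eY] := maxset_exists (tight_in_set1 eX).
have /maxsetP[/and3P[YX iY cY] _] := mY.
rewrite sub1set in eY.
have VY := connects_maxset_tight_in nl (leqnn 1) (imset_avoiding1_connects (v := v) pr) mY
  (covered_src eX) (covered_src eY).
apply: (covered_imset_leq (leqnn 1) pr (avoiding1_neq0 v) YX iY).
exact: leq_trans (subset_leq_card VY) cY.
Qed.

(** * Images of [G - v] under automorphisms of the bicircular matroid *)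

(** Without [e], the graph [G - v] is connected and still contains a cycle. This cycle grows to a
    spanning independent set with as many edges as vertices, and adding [e] closes a bicycle through
    [e]. *)
Lemma bicycle_avoiding v e : #|vert G| <= #|avoiding [set v]| ->
  e \in avoiding [set v] ->
  exists C, [/\ minset (dense 0) C, e \in C & C \subset avoiding [set v]].
Proof.
move=> nA eA; set A := avoiding [set v] in nA eA *.
have v3 : #|[set v]| < 3 by rewrite cards1.
have cA : covered A = ~: [set v] by exact: covered_avoiding.
have AeA : A :\ e \subset A by exact: subD1set.
have : dense 1 (A :\ e).
  have := cardsD1 e A; rewrite eA => cAe.
  have := subset_leq_card (coveredS AeA); rewrite cA cardsC1.
  have := c3.1; rewrite /dense -card_gt0; move: nA cAe; clear; lia.
case/minset_exists=> D mD DA; have /minsetP[dD Dmin] := mD.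
(* A cycle has as many edges as vertices, and by its minimality no subset has more edges than
   vertices. *)
have tD : tight_in 0 (A :\ e) D.
  have := minset_card (leqnn 1) mD; rewrite /tight_in DA /= => cD.
  apply/andP; split; last by move: cD; clear; lia.
  apply/independentP=> D' sD; apply/negP=> /andP[D'0 dD'].
  have E : D' = D.
    by apply: Dmin => //; rewrite /dense D'0; move: dD'; clear; lia.
  by move: dD' cD; rewrite E; clear; lia.
have [Y mY DY] := maxset_exists tD.
have /maxsetP[/and3P[YA iY cY] _] := mY.
have [f fD] := set0Pn _ (minset_neq0 mD).
have sV : src f \in ~: [set v].
  by rewrite -cA covered_src // (subsetP AeA) // (subsetP DA).
have VY := connects_maxset_tight_in nl (leq0n 1) (@avoiding1_D1_connects v e) mY sV
  (covered_src (subsetP DY f fD)).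
have eY : e \notin Y by apply/negP=> /(subsetP YA); rewrite setD11.
have eYA : e |: Y \subset A by rewrite subUset sub1set eA (subset_trans YA).
have : dense 0 (e |: Y).
  rewrite /dense -card_gt0 cardsU1 eY /=.
  have : covered (e |: Y) \subset covered Y.
    by apply: subset_trans (coveredS eYA) _; rewrite cA.
  by move/subset_leq_card; move: cY; clear; lia.
case/minset_exists=> C mC CY; have /minsetP[dC _] := mC.
exists C; split=> //; last exact: subset_trans CY eYA.
apply: contraLR dC => eC; apply: (independentP _ _ iY).
apply/subsetP=> x xC; have := subsetP CY x xC; rewrite in_setU1 => /predU1P[xe|//].
by rewrite -xe xC in eC.
Qed.

Lemma covered_imset_avoiding_bicycle (phi : {perm edge G}) v : preserves_minsets 0 phi ->
  #|vert G| <= #|avoiding [set v]| ->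
  #|covered (phi @: avoiding [set v])| <= #|covered (avoiding [set v])|.
Proof.
move=> pr nA; have [|F [FX iF cF]] := @bicycles_span G (phi @: avoiding [set v]) nl.
  move=> _ /imsetP[e eA ->]; have [C [mC eC CA]] := bicycle_avoiding nA eA.
  by exists (phi @: C); rewrite pr imset_f ?imsetS.
apply: (covered_imset_leq (leq0n 1) pr (avoiding1_neq0 v) FX iF).
by rewrite addn0.
Qed.

(** * Vertices whose deletion leaves few edges *)

Definition star_avoiding v x : {set edge G} :=
  [set e in avoiding [set v] | (src e == x) || (tgt e == x)].

Lemma sum_star_avoiding v : \sum_x #|star_avoiding v x| <= 2 * #|avoiding [set v]|.
Proof.
apply: (@leq_trans (\sum_x \sum_(e in avoiding [set v]) mult e x)).
  apply: leq_sum => x _; rewrite -sum1_card [X in _ <= X](bigID (fun e => e \in star_avoiding v x)) /=.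
  apply: leq_trans (leq_addr _ _).
  rewrite (eq_bigl (fun e => (e \in avoiding [set v]) && (e \in star_avoiding v x))).
    by apply: leq_sum => e /andP[_]; rewrite mult_gt0 inE => /andP[].
  by move=> e; rewrite [e \in star_avoiding _ _]inE andbA andbb.
rewrite exchange_big /= (eq_bigr (fun=> 2)) => [|e _]; last exact: sum_mult_vert.
by rewrite sum_nat_const mulnC.
Qed.

(** One edge leaves [x] in [G - v], and after its other end is deleted too, a second one does. *)
Lemma star_avoiding_gt1 v x : x != v -> 1 < #|star_avoiding v x|.
Proof.
move=> xv; have [||e [y [je yv eA]]] := @exit_edge [set v] x; rewrite ?cards1 ?inE //.
have yx : y != x.
  apply: contraTneq (nl e) => yx; move: je; rewrite yx /joins orbb.
  by case/andP=> /eqP-> /eqP->; rewrite eqxx.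
have [||e' [y' [je' yv' eA']]] := @exit_edge [set v; y] x.
- by rewrite cards2; case: eqP.
- by rewrite !inE negb_or xv eq_sym.
apply/card_gt1P; exists e, e'; split.
- by rewrite [_ \in _]inE eA (joins_ends je) eqxx.
- rewrite [_ \in _]inE (joins_ends je') eqxx andbT.
  by move: eA'; rewrite !inE !negb_or => /andP[/andP[-> _] /andP[-> _]].
apply: contraNneq yv' => ee; rewrite ee in je.
by rewrite (joins_inj je' je) !inE eqxx orbT.
Qed.

(** The [#|vert G| - 1] degrees in [G - v] are at least 2 and sum to at most [2 * (#|vert G| - 1)],
    so none exceeds 2. *)
Lemma star_avoiding_leq2 v x : #|avoiding [set v]| < #|vert G| -> x != v ->
  #|star_avoiding v x| <= 2.
Proof.
move=> small xv; rewrite leqNgt; apply/negP=> x3.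
have h : \sum_(y | y != v) (2 + (y == x)) <= \sum_(y | y != v) #|star_avoiding v y|.
  apply: leq_sum => y yv; have [->//|_] := eqVneq y x.
  by rewrite addn0 star_avoiding_gt1.
have := sum_star_avoiding v; rewrite (bigD1 v) //=.
have h1 : \sum_(y | y != v) (y == x : nat) > 0 by rewrite (bigD1 x) //= eqxx.
have h2 : \sum_(y | y != v) 2 = 2 * #|vert G|.-1.
  rewrite sum_nat_const mulnC; congr (_ * _); rewrite -(cardC1 v).
  by apply: eq_card => y; rewrite !inE.
rewrite big_split /= h2 in h; move: h h1 small; clear; lia.
Qed.

(** By 3-connectivity [x] has three distinct neighbours; if [v] were no neighbour of [x], all three
    edges would lie in [G - v]. *)
Lemma adjacent_of_small v x : #|avoiding [set v]| < #|vert G| -> x != v ->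
  exists e, joins e x v.
Proof.
move=> small xv; apply/existsP; apply: contraT => /existsPn nj.
have [||e1 [y1 [j1 _ _]]] := @exit_edge set0 x; rewrite ?cards0 ?inE //.
have nx e y : joins e x y -> x != y.
  move=> je; apply: contraTneq (nl e) => xy; move: je; rewrite -xy /joins orbb.
  by case/andP=> /eqP-> /eqP->; rewrite eqxx.
have [||e2 [y2 [j2 y12 _]]] := @exit_edge [set y1] x.
- by rewrite cards1.
- by rewrite inE (nx _ _ j1).
have [||e3 [y3 [j3 y123 _]]] := @exit_edge [set y1; y2] x.
- by rewrite cards2; case: eqP.
- by rewrite !inE negb_or (nx _ _ j1) (nx _ _ j2).
have star e y : joins e x y -> e \in star_avoiding v x.
  move=> je; rewrite inE mem_avoiding1 !(joins_ends je) eqxx andbT negb_or eq_sym xv /=.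
  by apply: contraTneq je => <-; exact: nj.
have := star_avoiding_leq2 small xv; rewrite leqNgt => /negP[].
apply/card_gt2P; exists e1, e2, e3; split; first by split; apply: star; eassumption.
have ne e e' y y' : joins e x y -> joins e' x y' -> y != y' -> e != e'.
  move=> je je' ny; apply: contraNneq ny => ee; rewrite -ee in je'.
  by rewrite (joins_inj je je').
move: y12 y123; rewrite !inE negb_or => n21 /andP[n31 n32].
split; [apply: (ne _ _ _ _ j1 j2)|apply: (ne _ _ _ _ j2 j3)|exact: (ne _ _ _ _ j3 j1)].
  by rewrite eq_sym.
by rewrite eq_sym.
Qed.

(* If [|E(G - v)| < |V|] then [G - v] is a cycle all of whose vertices are
   adjacent to [v], which has therefore degree at least 3 in [G - w]. *)
Lemma small_avoiding_unique v w : 5 <= #|vert G| ->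
  #|avoiding [set v]| < #|vert G| -> #|avoiding [set w]| < #|vert G| -> v = w.
Proof.
move=> n5 sv sw; apply/eqP; apply: contraT => vw.
have := star_avoiding_leq2 sw vw; rewrite leqNgt => /negP[].
pose other e := if src e == v then tgt e else src e.
(* All vertices but [v] and [w] are neighbours of [v] in [G - w], and there are at least 3 of
   them. *)
have sub : ~: [set v; w] \subset other @: star_avoiding w v.
  apply/subsetP=> x; rewrite !inE negb_or => /andP[xv xw].
  have [e je] := adjacent_of_small sv xv.
  apply/imsetP; exists e.
    rewrite inE mem_avoiding1 !(joins_ends je) eqxx orbT andbT negb_or.
    by rewrite !(eq_sym w) xw.
  move: je; rewrite /other /joins; case/orP=> /andP[/eqP-> /eqP->]; last by rewrite eqxx.
  by rewrite (negPf xv).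
have := leq_trans (subset_leq_card sub) (leq_imset_card _ _).
have := cardsC [set v; w]; rewrite cards2 vw.
by move: n5; clear; lia.
Qed.

(** * The vertex map induced by an automorphism *)

Lemma avoiding1_subset v w : avoiding [set v] \subset avoiding [set w] -> v = w.
Proof.
move/coveredS; rewrite !covered_avoiding ?cards1 // setCS sub1set.
by move/set1P.
Qed.

(** For [k = 0] this says that [G - v] has more edges than vertices, which rules out a cycle. *)
Definition large k v : bool := (k == 1) || (#|vert G| <= #|avoiding [set v]|).

Lemma imset_avoiding1_subset k (phi : {perm edge G}) v : k <= 1 ->
  preserves_minsets k phi -> large k v ->
  exists w, phi @: avoiding [set v] \subset avoiding [set w].
Proof.
move=> k1 pr lv.
have le : #|covered (phi @: avoiding [set v])| <= #|covered (avoiding [set v])|.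
  case: k k1 pr lv => [|[|//]] _ pr lv; last exact: covered_imset_avoiding_cycle.
  exact: covered_imset_avoiding_bicycle.
have [w wX] : exists w, w \notin covered (phi @: avoiding [set v]).
  apply/existsP; rewrite -negb_forall; apply/negP=> /forallP h.
  have : #|[set: vert G]| <= #|covered (phi @: avoiding [set v])|.
    by apply/subset_leq_card/subsetP=> x _.
  move=> h2; have := leq_trans h2 le.
  rewrite covered_avoiding ?cards1 // cardsT cardsC1.
  by have := c3.1; clear; lia.
exists w; apply/subsetP=> e eX; rewrite mem_avoiding1.
by apply: contra wX => ew; apply/coveredP; exists e.
Qed.

(** The inclusion for [phi] followed by the one for its inverse puts [E(G - v)] inside some
    [E(G - u)]; then [u = v] and both inclusions are equalities. *)
Lemma imset_avoiding1 k (phi : {perm edge G}) v : k <= 1 ->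
  preserves_minsets k phi -> large k v ->
  exists w, large k w && (phi @: avoiding [set v] == avoiding [set w]).
Proof.
move=> k1 pr lv; have [w sw] := imset_avoiding1_subset k1 pr lv.
have lw : large k w.
  case/orP: lv => [k'1|lv]; apply/orP; [by left|right].
  apply: leq_trans lv _; rewrite -(card_imset _ (@perm_inj _ phi)).
  exact: subset_leq_card.
have prV : preserves_minsets k (phi^-1)%g.
  move=> C; rewrite -[RHS](minset_preimset pr); congr minset.
  apply/setP=> e; rewrite inE; apply/imsetP/idP => [[x xC ->]|eC].
    by rewrite permKV.
  by exists (phi e); rewrite ?permK.
have [u su] := imset_avoiding1_subset k1 prV lw.
exists w; rewrite lw eqEsubset sw /=.
have vu : v = u.
  apply: avoiding1_subset; apply/subsetP=> e eA; apply: (subsetP su).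
  by apply/imsetP; exists (phi e); rewrite ?permK // (subsetP sw) ?imset_f.
subst u; apply/subsetP=> e eA; rewrite -[e](permKV phi) imset_f //.
by apply: (subsetP su); exact: imset_f.
Qed.

Lemma preserves_minsets_embedding k (phi : {perm edge G}) : 5 <= #|vert G| ->
  k <= 1 -> preserves_minsets k phi -> exists f, @embedding G G f phi.
Proof.
move=> n5 k1 pr.
pose image v w := large k w && (phi @: avoiding [set v] == avoiding [set w]).
(* The default [v] is taken exactly at a vertex that is not [large], and there is at most one such
   vertex. *)
pose f v := odflt v [pick w | large k v && image v w].
have fP v : large k v -> large k (f v) /\ phi @: avoiding [set v] = avoiding [set f v].
  move=> lv; rewrite /f; case: pickP => [w /and3P[_ lw /eqP pw]|no].
    by split.
  by have [w h] := imset_avoiding1 k1 pr lv; have := no w; rewrite lv /image h.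
have fN v : ~~ large k v -> f v = v.
  by move=> lv; rewrite /f; case: pickP => // w; rewrite (negPf lv).
have small v : ~~ large k v -> #|avoiding [set v]| < #|vert G|.
  by rewrite /large negb_or -ltnNge => /andP[].
have small_eq v w : ~~ large k v -> ~~ large k w -> v = w.
  by move=> /small sv /small sw; exact: small_avoiding_unique.
have fI : injective f.
  move=> v w; have [lv|lv] := boolP (large k v); have [lw|lw] := boolP (large k w).
  - move=> E; apply: avoiding1_subset.
    rewrite -(imset_inj (@perm_inj _ phi) _ : avoiding [set v] = avoiding [set w]) //.
    by rewrite (fP v lv).2 (fP w lw).2 E.
  - by rewrite (fN w) // => E; have := (fP v lv).1; rewrite E (negPf lw).
  - by rewrite (fN v) // => E; have := (fP w lw).1; rewrite -E (negPf lv).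
  - by move=> _; exact: small_eq.
have inc e v : large k v ->
    (src (phi e) == f v) || (tgt (phi e) == f v) = (src e == v) || (tgt e == v).
  move=> lv; apply: negb_inj; rewrite -!mem_avoiding1 -(fP v lv).2.
  by rewrite mem_imset //; exact: perm_inj.
have two e x y : large k x -> x != y -> joins e x y -> joins (phi e) (f x) (f y).
  move=> lx xy je.
  have [z jz] : exists z, joins (phi e) (f x) z.
    have : (src (phi e) == f x) || (tgt (phi e) == f x).
      by rewrite inc // (joins_ends je) eqxx.
    by case/orP=> /eqP <-; [exists (tgt (phi e))|exists (src (phi e))];
      rewrite /joins !eqxx ?orbT.
  have zx : z != f x.
    apply: contraTneq (nl (phi e)) => zx; move: jz; rewrite zx /joins orbb.
    by case/andP=> /eqP-> /eqP->; rewrite eqxx.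
  have [g fK gK] := injF_bij fI.
  suff -> : f y = z by [].
  have [ly|ly] := boolP (large k y).
    have : (src (phi e) == f y) || (tgt (phi e) == f y).
      by rewrite inc // (joins_ends je) eqxx orbT.
    by rewrite (joins_ends jz) (inj_eq fI) eq_sym (negPf xy) => /eqP.
  (* If the preimage of [z] were [large], it would be an end of [e]; but it is not [x], and [y] is
     not [large]. *)
  rewrite -(gK z); congr f; apply: small_eq => //; apply/negP=> lgz.
  have := inc e (g z) lgz; rewrite gK (joins_ends jz) eqxx orbT (joins_ends je).
  move/esym/orP=> [/eqP gx|/eqP gy]; last by rewrite -gy lgz in ly.
  by move: zx; rewrite -(gK z) gx eqxx.
exists f; split=> // [|e]; first exact: perm_inj.
have je : joins e (src e) (tgt e) by rewrite /joins !eqxx.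
have [ls|ls] := boolP (large k (src e)); first exact: two.
have [lt|lt] := boolP (large k (tgt e)); last by have := nl e; rewrite (small_eq _ _ ls lt) eqxx.
by rewrite joins_sym; apply: two; rewrite // 1?eq_sym // joins_sym.
Qed.

End ThreeConnected.

Theorem theorem4p3 (G : mgraph) (Gloopless : loopless G)
    (G3conn : three_connected G) (G5 : 5 <= #|vert G|) :
  fixing_number (cycle_matroid G) = fixing_number (bicircular_matroid G).
Proof.
(* An automorphism of the graph preserves the minimal dense sets for every value of [k]. *)
have aut k k' (phi : {perm edge G}) : k <= 1 ->
    preserves_minsets k phi -> preserves_minsets k' phi.
  move=> k1 /(preserves_minsets_embedding Gloopless G3conn G5 k1)[f emb] C.
  exact: (minset_imset emb).
have autP k (M : matroid (edge G)) : (forall C, circuit M C = minset (dense k) C) ->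
    forall phi : {perm edge G}, automorphism M phi <-> preserves_minsets k phi.
  move=> cM phi; split=> [/forallP h C|h].
    by have /eqP := h C; rewrite !cM.
  by apply/forallP=> C; rewrite !cM h.
have cycA := autP 1 (cycle_matroid G) (@Defs.cycleP G).
have bicA := autP 0 (bicircular_matroid G) (@bicycleP G).
have autE : automorphism (cycle_matroid G) =1 automorphism (bicircular_matroid G).
  move=> phi; apply/idP/idP.
    by move/cycA/(aut 1 0 _ isT)/bicA.
  by move/bicA/(aut 0 1 _ isT)/cycA.
have fixE : fixing_set (cycle_matroid G) = fixing_set (bicircular_matroid G).
  by apply/funext=> S; apply: eq_forallb => phi; rewrite autE.
by rewrite /fixing_number fixE.
Qed.
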